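(* Let $k\ge 1$ be an integer and let $G$ be a $k$-connected biconvex graph. Then a CDS partition of $G$ of size $k$ exists, and it can be computed in polynomial time.
   Context: All graphs are finite, undirected and simple. A graph is $k$-connected if it has more than $k$ vertices and the removal of any vertex set of size at most $k-1$ does not disconnect it. A bipartite graph $G=(A\cup B,E)$ (with parts $A$, $B$) is called biconvex if there exist linear orderings $\sigma_A$ of $A$ and $\sigma_B$ of $B$ such that for each $v\in A$ the neighbourhood $N(v)\subseteq B$ is consecutive under $\sigma_B$, and for each $v\in B$ the neighbourhood $N(v)\subseteq A$ is consecutive under $\sigma_A$. A connected dominating set (CDS) of $G$ is a nonempty set $S\subseteq V(G)$ such that $G[S]$ is connected and every vertex of $V(G)\setminus S$ is adjacent to some vertex of $S$. A CDS partition of $G$ of size $k$ is a partition of $V(G)$ into $k$ pairwise disjoint sets, each of which is a connected dominating set of $G$. *)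

(* Defs.v *)
From mathcomp Require Import all_boot.

Set Implicit Arguments.
Unset Strict Implicit.
Unset Printing Implicit Defensive.

Record sgraph (T : finType) := SGraph {
  adj :> rel T;
  adj_sym : symmetric adj;
  adj_irrefl : irreflexive adj }.

Section Graphs.

Variables (T : finType) (G : sgraph T).

Definition nbhd (v : T) : {set T} := [set w | G v w].

(* The subgraph induced by A is connected; vacuously true for A = set0. *)
Definition connected_in (A : {set T}) : Prop :=
  {in A &, forall x y, connect [rel u v | [&& u \in A, v \in A & G u v]] x y}.

Definition k_connected (k : nat) : Prop :=
  k < #|T| /\ forall X : {set T}, #|X| < k -> connected_in (~: X).

Definition linear_order_on (A : {set T}) (le : rel T) : Prop :=
  [/\ {in A, reflexive le}, {in A &, antisymmetric le},
      {in A & &, transitive le} & {in A &, total le}].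

(* N, a subset of A, has no gap with respect to the ordering le of A. *)
Definition consecutive (A : {set T}) (le : rel T) (N : {set T}) : Prop :=
  {in A & &, forall x y z, le x y -> le y z -> x \in N -> z \in N -> y \in N}.

Definition bipartition (A B : {set T}) : Prop :=
  [/\ A :|: B = [set: T], A :&: B = set0
    & forall x y, G x y -> (x \in A) && (y \in B) || (x \in B) && (y \in A)].

Definition biconvex : Prop :=
  exists (A B : {set T}) (leA leB : rel T),
    [/\ bipartition A B, linear_order_on A leA, linear_order_on B leB,
        {in A, forall v, consecutive B leB (nbhd v)}
      & {in B, forall v, consecutive A leA (nbhd v)}].

Definition connected_dominating (S : {set T}) : Prop :=
  [/\ S != set0, connected_in S
    & forall v, v \notin S -> exists2 w, w \in S & G v w].

Definition CDS_partition (k : nat) (P : {set {set T}}) : Prop :=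
  [/\ partition P [set: T], #|P| = k
    & {in P, forall S, connected_dominating S}].

End Graphs.

(* Model of computation: structured programs for a random-access machine.    *)
(* The memory consists of arrays of natural numbers, [s a i] being cell i of *)
(* array a; array names are constants of the program, so that a program uses *)
(* finitely many of them, whereas indices are computed.  Every assignment    *)
(* and every test costs one unit of time.  As the only arithmetic operations *)
(* are addition and truncated subtraction (no multiplication), a given       *)
(* program lengthens the largest number in memory by O(1) bits per step, so  *)
(* polynomial time here is polynomial time on a Turing machine.              *)

Definition store := nat -> nat -> nat.

Inductive expr :=
| Const of nat
| Read of nat & expr
| Add of expr & expr
| Sub of expr & expr.

Fixpoint eval (s : store) (x : expr) : nat :=
  match x with
  | Const m => m
  | Read a i => s a (eval s i)
  | Add x1 x2 => eval s x1 + eval s x2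
  | Sub x1 x2 => eval s x1 - eval s x2
  end.

Definition update (s : store) (a i m : nat) : store :=
  fun b j => if (b == a) && (j == i) then m else s b j.

Inductive prog :=
| Skip
| Write of nat & expr & expr (* Write a i x: cell i of array a becomes x *)
| Seq of prog & prog
| If of expr & prog & prog
| While of expr & prog.

(* [exec p s t s']: started on s, p halts on s' after t units of time.  *)
(* A test succeeds when its value is nonzero.                           *)
Inductive exec : prog -> store -> nat -> store -> Prop :=
| ExecSkip s : exec Skip s 1 s
| ExecWrite a i x s :
    exec (Write a i x) s 1 (update s a (eval s i) (eval s x))
| ExecSeq p q s1 s2 s3 t1 t2 :
    exec p s1 t1 s2 -> exec q s2 t2 s3 -> exec (Seq p q) s1 (t1 + t2) s3
| ExecIfTrue x p q s1 s2 t :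
    eval s1 x != 0 -> exec p s1 t s2 -> exec (If x p q) s1 t.+1 s2
| ExecIfFalse x p q s1 s2 t :
    eval s1 x = 0 -> exec q s1 t s2 -> exec (If x p q) s1 t.+1 s2
| ExecWhileTrue x p s1 s2 s3 t1 t2 :
    eval s1 x != 0 -> exec p s1 t1 s2 -> exec (While x p) s2 t2 s3 ->
    exec (While x p) s1 (t1 + t2).+1 s3
| ExecWhileFalse x p s :
    eval s x = 0 -> exec (While x p) s 1 s.

(* Array 0 holds n and k, array 1 the adjacency matrix of G in row-major  *)
(* order; every other cell is 0.                                          *)
Definition input (k n : nat) (G : sgraph 'I_n) : store := fun a i =>
  match a with
  | 0 => nth 0 [:: n; k] i
  | 1 => nth 0 [seq nat_of_bool (G u v) | u <- enum 'I_n, v <- enum 'I_n] i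
  | _ => 0
  end.

(* Cell v of array 2 holds a label of the vertex v; the blocks of the  *)
(* output partition are the sets of vertices with the same label.      *)
Definition output (n : nat) (s : store) : {set {set 'I_n}} :=
  preim_partition (fun v : 'I_n => s 2 v) [set: 'I_n].

(* Main.v *)
(** Lay out each side of a connected biconvex graph linearly and let [r], [r']
    (resp. [c], [c']) be the extreme vertices of the first (resp. second) side;
    then a connected set meeting the neighbourhoods of all four of them is
    dominating.  Exchanging [c] and [c'] if necessary, N(r) x N(c) and
    N(r') x N(c') are complete.  Let X be the union of N(r) and N(c), and Y that
    of N(r') and N(c').  By k-connectivity there are k disjoint X-Y paths, each
    of them having one vertex in X and one in Y; since all degrees are at least
    k, unused vertices of the four neighbourhoods can be attached to the paths,
    as leaves, until each path meets the four neighbourhoods.  This gives k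
    disjoint connected dominating sets.

    The paths come from a bipartite matching (Hall's theorem replacing Menger's):
    an injective partial map from V \ X to V \ Y sending every vertex to itself
    or to a neighbour, and of size at least |V| - |X| - |Y| + k, has at least k
    orbits joining Y to X.  Such a map is computed by an auction.  The program
    needs no ordering of the vertices: it tries all quadruples [r], [r'], [c],
    [c'], and keeps the first one for which the k sets turn out to be
    dominating. *)

Require Import Defs.
From mathcomp Require Import all_boot zify.

Set Implicit Arguments.
Unset Strict Implicit.
Unset Printing Implicit Defensive.

(** * Biconvex graphs *)

(** The delicate step is the attachment of free vertices. A free vertex of N(r) may also lie in
    N(r'), and giving it to a path that already meets N(r') would put two vertices of one path into
    N(r'); the count that guarantees a free neighbour for every remaining path would then fail.
    Hence common neighbours are preferred, and hence the condition [balanced]. To have it at the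
    beginning, the vertices common to X and Y are taken as one-vertex paths before any longer path.
    The completeness of N(r) x N(c) is what makes an attached vertex a leaf: a path missing N(r)
    meets N(c), and so is adjacent to every vertex of N(r). Whether a quadruple is controlling
    depends on all connected sets and is never tested: the program tests compatibility, on which the
    construction rests, and then domination, which a controlling quadruple ensures. An auction suits
    counted loops, as its invariant is local and the sum of the prices bounds the number of bids. *)

Section Closed.

Variables (T : finType) (G : sgraph T).

(** Connectivity as an induction principle: later arguments exhibit a property that spreads along
    the edges inside [S]. *)
Lemma connected_closed (S : {set T}) (P : pred T) x y :
  connected_in G S -> x \in S -> y \in S -> P x ->
  (forall u v, u \in S -> v \in S -> G u v -> P u -> P v) -> P y.
Proof.
move=> cS xS yS Px clP; have /connectP[p] := cS x y xS yS.
elim: p x xS Px => [|z p IHp] x xS Px /=; first by move=> _ ->.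
case/andP=> /and3P[_ zS Gxz] pzp; apply: IHp pzp => //.
exact: clP Gxz Px.
Qed.

Lemma connected_inU1 (S : {set T}) u w :
  connected_in G S -> w \in S -> G u w -> connected_in G (u |: S).
Proof.
move=> cS wS Guw.
pose e := [rel a b | [&& a \in u |: S, b \in u |: S & G a b]].
have sub x y : x \in S -> y \in S -> connect e x y.
  move=> xS yS; apply: connect_sub (cS x y xS yS) => a b /and3P[aS bS Gab].
  by apply: connect1; rewrite /e /= !inE aS bS Gab !orbT.
have uw : connect e u w by apply: connect1; rewrite /e /= !inE eqxx wS Guw orbT.
have wu : connect e w u.
  by apply: connect1; rewrite /e /= !inE eqxx wS orbT adj_sym Guw.
move=> x y; rewrite !inE => /orP[/eqP->|xS] /orP[/eqP->|yS] //.
- exact: connect_trans uw (sub _ _ wS yS).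
- exact: connect_trans (sub _ _ xS wS) wu.
- exact: sub.
Qed.

Lemma connected_inS (S U : {set T}) :
  connected_in G S -> S \subset U ->
  (forall u, u \in U -> u \notin S -> exists2 w, w \in S & G u w) ->
  connected_in G U.
Proof.
move=> cS sSU dU.
pose e := [rel a b | [&& a \in U, b \in U & G a b]].
have sub x y : x \in S -> y \in S -> connect e x y.
  move=> xS yS; apply: connect_sub (cS x y xS yS) => a b /and3P[aS bS Gab].
  by apply: connect1; rewrite /e /= !(subsetP sSU) // Gab.
have toS x : x \in U -> exists2 w, w \in S & connect e x w && connect e w x.
  move=> xU; have [xS|xS] := boolP (x \in S); first by exists x; rewrite ?connect0.
  have [w wS Gxw] := dU x xU xS; exists w => //.
  have wU := subsetP sSU _ wS.
  by rewrite !connect1 // /e /= xU wU ?Gxw // adj_sym.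
move=> x y /toS[u uS /andP[xu _]] /toS[v vS /andP[_ vy]].
exact: connect_trans xu (connect_trans (sub _ _ uS vS) vy).
Qed.

End Closed.

Section Convex.

Variables (T : finType) (G : sgraph T) (side : pred T).

(** One position function serves both sides, since only positions on the same side are ever
    compared. *)
Definition convex_layout (pos : T -> nat) :=
  (forall u v, G u v -> side u = ~~ side v) /\
  (forall v x y z, G v x -> G v z -> side y = side x ->
     pos x <= pos y -> pos y <= pos z -> G v y).

(** If [S] contained no neighbour of [y], convexity would force each vertex of [S] on the other side
    to have all its neighbours before [y] or all after [y], and [S] could not lead from [w1] to
    [w2]. *)
Lemma dominates_between pos (S : {set T}) w1 w2 x y z :
  convex_layout pos -> connected_in G S -> w1 \in S -> w2 \in S ->
  G w1 x -> G w2 z -> side x = side y -> side z = side y ->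
  pos x <= pos y -> pos y <= pos z -> exists2 w, w \in S & G y w.
Proof.
move=> [cr cv] cS w1S w2S G1 G2 sx sz xy yz.
have [/exists_inP[w wS Gyw]|/exists_inPn N] :=
  boolP [exists w in S, G y w]; first by exists w.
have nG w : w \in S -> ~ G w y by move=> wS; rewrite adj_sym; apply/negP/N.
pose P u := if side u == side y then pos u < pos y
            else [exists v, G u v && (pos v < pos y)].
have P1 : P w1.
  have -> : P w1 = [exists v, G w1 v && (pos v < pos y)].
    by rewrite /P (cr _ _ G1) sx; case: (side y).
  apply/existsP; exists x; rewrite G1 ltnNge; apply/negP => yx.
  by apply: (nG _ w1S); apply: (cv w1 x y x).
have : P w2.
  apply: connected_closed cS w1S w2S P1 _ => u v uS vS Guv; rewrite /P.
  have := cr _ _ Guv; have [su suv|su suv] := eqVneq (side u) (side y).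
    have -> : (side v == side y) = false by move: suv; rewrite su; do 2!case: side.
    by move=> uy; apply/existsP; exists u; rewrite adj_sym Guv.
  have sv : side v = side y by move: su suv; do 3!case: side.
  rewrite sv eqxx => /existsP[t /andP[Gut ty]].
  rewrite ltnNge; apply/negP => yv; case: (nG _ uS).
  apply: (cv u t y v) => //; last exact: ltnW.
  by have := cr _ _ Gut; move: suv; rewrite sv; do 3!case: side.
have sw2 := cr _ _ G2; rewrite /P.
have -> : (side w2 == side y) = false by rewrite sw2 sz; case: side.
move=> /existsP[t /andP[Gt ty]]; case: (nG _ w2S).
apply: (cv w2 t y z) => //; last exact: ltnW.
by have := cr _ _ Gt; rewrite sw2 sz; do 2!case: side.
Qed.

(** Without such a [w], the vertices of this side at positions up to [m], together with their
    neighbours, would be closed under adjacency. *)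
Lemma crossing_vertex pos m x0 z0 :
  convex_layout pos -> connected_in G setT -> side x0 = side z0 ->
  pos x0 <= m < pos z0 ->
  exists w x z, [/\ G w x, G w z, side x = side z0, side z = side z0
                  & pos x <= m < pos z].
Proof.
move=> [cr cv] cG s0 /andP[x0m mz0].
pose Q w x z := [&& G w x, G w z, side x == side z0, side z == side z0,
                   pos x <= m & m < pos z].
have [/existsP[w /existsP[x /existsP[z]]]|N] :=
  boolP [exists w, exists x, exists z, Q w x z].
  by case/and5P=> Gx Gz /eqP sx /eqP sz mm; exists w, x, z.
have nQ w x z : ~ Q w x z.
  by move=> q; case/negP: N; apply/existsP; exists w; apply/existsP; exists x;
     apply/existsP; exists z.
pose P u := if side u == side z0 then pos u <= m
            else [exists v, G u v && (pos v <= m)].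
have : P z0.
  have P0 : P x0 by rewrite /P s0 eqxx.
  apply: (connected_closed cG _ _ P0); rewrite ?inE // => u v _ _ Guv.
  have := cr _ _ Guv; rewrite /P; have [su suv|su suv] := eqVneq (side u) (side z0).
    have -> : (side v == side z0) = false by move: suv; rewrite su; do 2!case: side.
    by move=> um; apply/existsP; exists u; rewrite adj_sym Guv.
  have sv : side v = side z0 by move: su suv; do 3!case: side.
  rewrite sv eqxx => /existsP[t /andP[Gut tm]].
  rewrite leqNgt; apply/negP => mv; apply: (nQ u t v).
  rewrite /Q Gut Guv sv eqxx tm mv !andbT.
  by have := cr _ _ Gut; move: suv; rewrite sv; do 3!case: side.
by rewrite /P eqxx leqNgt mz0.
Qed.

(* A missing cell [(l, t)] with [t] in the first row and [l] in the first      *)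
(* column confines all edges to the rows before [l] or the columns before [t]. *)
Lemma broken_corner pos r c t l :
  convex_layout pos -> connected_in G setT -> side r = ~~ side c ->
  (forall x, side x = side r -> pos r <= pos x) ->
  (forall x, side x = side c -> pos c <= pos x) ->
  G r t -> G c l -> ~~ G t l ->
  forall a b, G a b -> side a = side r -> (pos a < pos l) || (pos b < pos t).
Proof.
move=> lay cG src rmin cmin Grt Gcl ntl a b Gab sa.
have [cr cv] := lay.
have st : side t = side c by have := cr _ _ Grt; rewrite src; do 2!case: side.
have sl : side l = side r by have := cr _ _ Gcl; rewrite src; do 2!case: side.
have sb : side b = side c by have := cr _ _ Gab; rewrite sa src; do 2!case: side.
have rowt x : side x = side r -> pos l <= pos x -> ~~ G x t.
  move=> sx lx; apply: contra ntl; rewrite (adj_sym _ x) => Gtx.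
  by apply: (cv t r l x) => //; [rewrite adj_sym | apply: rmin].
apply: contraT; rewrite negb_or -!leqNgt => /andP[la tb].
pose P x := [&& side x == side r, pos l <= pos x, pos x <= pos a
              & [exists w, G x w && (pos w <= pos t)]].
have Pl : P l.
  rewrite /P sl eqxx leqnn la; apply/existsP; exists c.
  by rewrite adj_sym Gcl cmin.
have aP w : G a w -> pos t < pos w.
  move=> Gaw; rewrite ltnNge; apply/negP => wt; case/negP: (rowt a sa la).
  by apply: (cv a w t b) => //; rewrite st; have := cr _ _ Gaw; rewrite sa src; do 2!case: side.
(* Let [p] be the last row from [l] to [a] with a neighbour not after [t]. A column [w] crossing
   from [p] to later rows is itself not after [t]; it yields either a later row of this kind or a
   neighbour of [a] not after [t], and both are excluded. *)
case: (arg_maxnP pos Pl) => p /and4P[/eqP sp lp pa /existsP[w0 /andP[Gpw0 w0t]]] pmax.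
have neq : pos p < pos a.
  rewrite ltn_neqAle pa andbT; apply/eqP => epa.
  have : G a w0 by rewrite adj_sym; apply: (cv w0 p a p); rewrite ?epa ?sa ?sp // adj_sym.
  by move/aP; rewrite ltnNge w0t.
have [w [x [z [Gwx Gwz sx sz /andP[xp pz]]]]] :
  exists w x z, [/\ G w x, G w z, side x = side a, side z = side a
                  & pos x <= pos p < pos z].
  by apply: (@crossing_vertex pos (pos p) p a); rewrite ?sp ?leqnn //.
have Gpw : G p w.
  by rewrite adj_sym; apply: (cv w x p z) => //; rewrite ?(ltnW pz) // sp sx.
have sw : side w = side c by have := cr _ _ Gpw; rewrite sp src; do 2!case: side.
have wt : pos w <= pos t.
  rewrite leqNgt; apply/negP => tw; case/negP: (rowt p sp lp).
  apply: (cv p w0 t w) => //; rewrite ?(ltnW tw) //.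
  by rewrite st; have := cr _ _ Gpw0; rewrite sp src; do 2!case: side.
have [za|az] := leqP (pos z) (pos a).
  have Pz : P z; last by have /= := pmax _ Pz; rewrite leqNgt pz.
  rewrite /P sz sa eqxx za (leq_trans lp (ltnW pz)).
  by apply/existsP; exists w; rewrite adj_sym Gwz.
have Gaw : G a w.
  rewrite adj_sym; apply: (cv w x a z) => //; last exact: ltnW.
  exact: leq_trans xp (ltnW neq).
by have := aP _ Gaw; rewrite ltnNge wt.
Qed.

(** Reflection of the order of one side; subtracting from the maximum keeps the positions natural
    numbers. *)
Definition flip pos s x :=
  if side x == s then \max_y pos y - pos x else pos x.

Lemma flipE pos s x y : side x = s -> side y = s ->
  (flip pos s x <= flip pos s y) = (pos y <= pos x).
Proof.
by move=> sx sy; rewrite /flip sx sy eqxx leq_sub2lE // leq_bigmax.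
Qed.

Lemma flip_convex pos s : convex_layout pos -> convex_layout (flip pos s).
Proof.
move=> [cr cv]; split=> // v x y z Gx Gz syx.
have szx : side z = side x by have := cr _ _ Gz; rewrite (cr _ _ Gx); do 2!case: side.
have [e|/negPf ne] := eqVneq (side x) s.
  rewrite !flipE ?syx ?szx // => yx zy.
  by apply: (cv v z y x) => //; rewrite syx szx.
by rewrite /flip syx szx ne; apply: cv.
Qed.

End Convex.

Section Ends.

Variables (T : finType) (G : sgraph T).

(** The two sides are not mentioned, so a quadruple can be tested without knowing a bipartition. The
    last two conditions stand for the fact that [r] and [r'] lie on one side, [c] and [c'] on the
    other. *)
Definition compatible r r' c c' :=
  [/\ forall u v, G r u -> G c v -> G u v,
      forall u v, G r' u -> G c' v -> G u v,
      forall u, G r u -> ~~ G c' u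
    & forall u, G c u -> ~~ G r' u].

Definition hits (S : {set T}) z := [exists u in S, G z u].

Definition controlling r r' c c' := forall S : {set T},
  connected_in G S -> hits S r -> hits S r' -> hits S c -> hits S c' ->
  forall v, v \notin S -> exists2 w, w \in S & G v w.

Lemma biconvex_layout :
  biconvex G -> exists (side : pred T) (pos : T -> nat), convex_layout G side pos.
Proof.
case=> A [B [leA [leB [[AB AB0 cr] loA loB cA cB]]]].
have sB x : (x \in B) = (x \notin A).
  have := in_set0 x; rewrite -AB0 inE; have := in_setT x; rewrite -AB inE.
  by case: (x \in A); case: (x \in B).
pose rk (C : {set T}) (le : rel T) x := #|[set y in C | le y x]|.
have rkP C le x y : linear_order_on C le -> x \in C -> y \in C ->
    rk C le x <= rk C le y -> le x y.
  move=> [rf _ tr tot] xC yC; apply: contraLR => nxy; rewrite -ltnNge.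
  have yx : le y x by have := tot x y xC yC; rewrite (negPf nxy).
  apply: proper_card; apply/properP; split.
    by apply/subsetP=> z; rewrite !inE => /andP[zC zy]; rewrite zC (tr y z x).
  by exists x; rewrite !inE xC ?rf.
exists (fun x => x \in A), (fun x => if x \in A then rk A leA x else rk B leB x).
split=> [u v /cr|v x y z Gx Gz /= syx].
  by rewrite !sB; case: (u \in A); case: (v \in A).
have szx : (z \in A) = (x \in A).
  by have := cr _ _ Gz; have := cr _ _ Gx; rewrite !sB; case: (x \in A); case: (z \in A); case: (v \in A).
rewrite syx szx; have [xA|xA] := boolP (x \in A).
  have vB : v \in B by have := cr _ _ Gx; rewrite !sB xA; case: (_ \in A).
  rewrite xA in syx szx => xy yz.
  have := cB v vB x y z xA syx szx (rkP _ _ _ _ loA xA syx xy) (rkP _ _ _ _ loA syx szx yz).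
  by rewrite !inE; apply.
have vA : v \in A by have := cr _ _ Gx; rewrite !sB (negPf xA) andbF orbF; case: (_ \in A).
rewrite (negPf xA) in syx szx => xy yz.
have xB : x \in B by rewrite sB xA.
have yB : y \in B by rewrite sB syx.
have zB : z \in B by rewrite sB szx.
have := cA v vA x y z xB yB zB (rkP _ _ _ _ loB xB yB xy) (rkP _ _ _ _ loB yB zB yz).
by rewrite !inE; apply.
Qed.

(** View the graph as a 0-1 matrix in the convex orders and call a corner whole when the
    neighbourhoods of its row and of its column are completely joined. A corner that is not whole
    forces strict comparisons between the neighbourhoods of the two extreme rows, and between those
    of the two extreme columns. If neither diagonal had both its corners whole, each diagonal would
    contain a broken one; these two corners lie on a common border of the matrix, and their
    comparisons contradict each other. *)
Lemma exists_controlling :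
  1 < #|T| -> connected_in G setT -> biconvex G ->
  exists r r' c c', compatible r r' c c' /\ controlling r r' c c'.
Proof.
move=> T1 cG /biconvex_layout[side [pos lay]].
have [cr cv] := lay.
have [x0 [y0 G0]] : exists x y, G x y.
  have [x _ [y _ xy]] : exists2 x, x \in T & exists2 y, y \in T & x != y.
    by case/card_gt1P: T1 => x [y [xT yT xy]]; exists x => //; exists y.
  have [/existsP[z Gxz]|/existsPn N] := boolP [exists z, G x z]; first by exists x, z.
  have : y == x.
    apply: (connected_closed (P := pred1 x) cG (in_setT x) (in_setT y)) => //=.
    by move=> u v _ _ Guv /eqP eu; case/negP: (N v); rewrite -eu.
  by rewrite eq_sym (negPf xy).
have s0 := cr _ _ G0.
have ends x : exists a b, [/\ side a = side x, side b = side x,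
    forall y, side y = side x -> pos a <= pos y &
    forall y, side y = side x -> pos y <= pos b].
  case: (@arg_minnP _ x (fun y => side y == side x) pos) => // a /eqP sa amin.
  case: (@arg_maxnP _ x (fun y => side y == side x) pos) => // b /eqP sb bmax.
  by exists a, b; split=> // y /eqP; [apply: amin | apply: bmax].
have [r1 [rR [sr1 srR r1min rRmax]]] := ends x0.
have [c1 [cC [sc1 scC c1min cCmax]]] := ends y0.
have ctrl c c' : (c, c') = (c1, cC) \/ (c, c') = (cC, c1) -> controlling r1 rR c c'.
  move=> e S cS.
  move=> /exists_inP[w1 w1S /[dup] G1]; rewrite adj_sym => {}G1.
  move=> /exists_inP[w2 w2S /[dup] G2]; rewrite adj_sym => {}G2.
  move=> h3 h4 v _.
  have [/exists_inP[w3 w3S G3] /exists_inP[w4 w4S G4]] : hits S c1 /\ hits S cC.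
    by case: e h3 h4 => -[-> ->].
  rewrite adj_sym in G3; rewrite adj_sym in G4.
  have [sv|sv] : side v = side x0 \/ side v = side y0.
    by rewrite s0; case: (side v); case: (side y0); auto.
    by apply: (dominates_between lay cS w1S w2S G1 G2); rewrite ?sr1 ?srR ?r1min ?rRmax.
  by apply: (dominates_between lay cS w3S w4S G3 G4); rewrite ?sc1 ?scC ?c1min ?cCmax.
have disj r c : side r = side x0 -> side c = side y0 -> forall u, G r u -> ~~ G c u.
  by move=> sr sc u /cr; rewrite sr s0 => e; apply/negP => /cr; rewrite sc; move: e; case: (side y0); case: (side u).
have disj' r c : side r = side x0 -> side c = side y0 -> forall u, G c u -> ~~ G r u.
  by move=> sr sc u Gc; apply/negP => /(disj _ _ sr sc); rewrite Gc.
pose bic r c := [forall u, forall v, G r u ==> G c v ==> G u v].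
have bicP r c : bic r c -> forall u v, G r u -> G c v -> G u v.
  by move=> /forallP H u v Gu Gv; have /forallP/(_ v) := H u; rewrite Gu Gv.
suff : (bic r1 c1 && bic rR cC) || (bic r1 cC && bic rR c1).
  case/orP=> /andP[b1 b2].
    exists r1, rR, c1, cC; split; last by apply: ctrl; left.
    by split; [exact: bicP|exact: bicP|exact: disj|exact: disj'].
  exists r1, rR, cC, c1; split; last by apply: ctrl; right.
  by split; [exact: bicP|exact: bicP|exact: disj|exact: disj'].
have nbicP r c : ~~ bic r c -> exists t l, [/\ G r t, G c l & ~~ G t l].
  rewrite negb_forall => /existsP[t]; rewrite negb_forall => /existsP[l].
  by rewrite !negb_imply => /and3P[]; exists t, l.
have nbr x : exists u, G x u.
  have [/existsP//|/existsPn N] := boolP [exists z, G x z].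
  have xP y : y == x.
    apply: (connected_closed (P := pred1 x) cG (in_setT x) (in_setT y)) => //=.
    by move=> u v _ _ Guv /eqP eu; case/negP: (N v); rewrite -eu.
  by move: s0; rewrite (eqP (xP x0)) (eqP (xP y0)); case: (side x).
(* The layout [p] is arbitrary so that reflections can turn any corner into the first one. For edges
   at the last row [r'] the alternative on rows in [broken_corner] is impossible, so all of them end
   before [t]; likewise for the last column [c']. *)
have broken p r c r' c' : convex_layout G side p ->
    side r = side x0 -> side r' = side x0 -> side c = side y0 -> side c' = side y0 ->
    (forall x, side x = side x0 -> p r <= p x <= p r') ->
    (forall y, side y = side y0 -> p c <= p y <= p c') -> ~~ bic r c ->
    (exists2 t, G r t & forall b, G r' b -> p b < p t) /\
    (exists2 l, G c l & forall a, G c' a -> p a < p l).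
  move=> layp sr sr' sc sc' rm cm /nbicP[t [l [Grt Gcl ntl]]].
  have sl : side l = side x0 by rewrite s0 -sc (cr _ _ Gcl) negbK.
  have st : side t = side y0 by move: s0; rewrite -sr (cr _ _ Grt); case: (side t); case: (side y0).
  have br a b : G a b -> side a = side x0 -> (p a < p l) || (p b < p t).
    move=> Gab sa; apply: (broken_corner layp cG (r := r) (c := c)) => //.
    - by rewrite sr sc.
    - by move=> x; rewrite sr => /rm/andP[].
    - by move=> x; rewrite sc => /cm/andP[].
    - by rewrite sr.
  split.
    exists t => // b Gb; have := br _ _ Gb sr'.
    by rewrite ltnNge; have /andP[_ ->] := rm _ sl.
  exists l => // a Ga; have sa : side a = side x0 by rewrite s0 -sc' (cr _ _ Ga) negbK.
  rewrite adj_sym in Ga; have := br _ _ Ga sa.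
  by rewrite orbC ltnNge; have /andP[_ ->] := cm _ st.
have r1m x : side x = side x0 -> pos r1 <= pos x <= pos rR by move=> e; rewrite r1min ?rRmax.
have c1m x : side x = side y0 -> pos c1 <= pos x <= pos cC by move=> e; rewrite c1min ?cCmax.
have frow x y : side x = side x0 -> side y = side x0 ->
    flip side pos (side x0) x <= flip side pos (side x0) y = (pos y <= pos x) by apply: flipE.
have fcol x y : side x = side y0 -> side y = side y0 ->
    flip side pos (side y0) x <= flip side pos (side y0) y = (pos y <= pos x) by apply: flipE.
have frow' y : side y = side y0 -> flip side pos (side x0) y = pos y.
  by move=> sy; rewrite /flip sy s0; case: (side y0).
have fcol' x : side x = side x0 -> flip side pos (side y0) x = pos x.
  by move=> sx; rewrite /flip sx s0; case: (side y0).
have srow r u : side r = side x0 -> G r u -> side u = side y0.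
  by move=> sr /cr; rewrite sr s0; case: (side u); case: (side y0).
have scol c u : side c = side y0 -> G c u -> side u = side x0.
  by move=> sc /cr; rewrite sc s0; case: (side u); case: (side y0).
have NW := broken pos r1 c1 rR cC lay sr1 srR sc1 scC r1m c1m.
have NE : ~~ bic r1 cC ->
    (exists2 t, G r1 t & forall b, G rR b -> pos t < pos b) /\
    (exists2 l, G cC l & forall a, G c1 a -> pos a < pos l).
  move=> nb; have [] := broken _ r1 cC rR c1 (flip_convex (side y0) lay) sr1 srR scC sc1 _ _ nb.
  - by move=> x sx; rewrite !fcol' ?r1m.
  - by move=> y sy; rewrite !fcol // andbC c1m.
  - case=> t Gt Ht [l Gl Hl]; split.
      exists t => // b Gb; rewrite ltnNge -fcol ?(srow r1 t) ?(srow rR b) //.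
      by rewrite -ltnNge Ht.
    by exists l => // a Ga; have := Hl _ Ga; rewrite !fcol' ?(scol cC l) ?(scol c1 a).
have SW : ~~ bic rR c1 ->
    (exists2 b, G rR b & forall t, G r1 t -> pos t < pos b) /\
    (exists2 l, G c1 l & forall a, G cC a -> pos l < pos a).
  move=> nb; have [] := broken _ rR c1 r1 cC (flip_convex (side x0) lay) srR sr1 sc1 scC _ _ nb.
  - by move=> x sx; rewrite !frow // andbC r1m.
  - by move=> y sy; rewrite !frow' ?c1m.
  - case=> t Gt Ht [l Gl Hl]; split.
      by exists t => // b Gb; have := Ht _ Gb; rewrite !frow' ?(srow rR t) ?(srow r1 b).
    exists l => // a Ga; rewrite ltnNge -frow ?(scol c1 l) ?(scol cC a) //.
    by rewrite -ltnNge Hl.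
have SE : ~~ bic rR cC ->
    (exists2 b, G rR b & forall t, G r1 t -> pos b < pos t) /\
    (exists2 a, G cC a & forall l, G c1 l -> pos a < pos l).
  pose p2 := flip side (flip side pos (side x0)) (side y0).
  have p2E x y : side x = side y -> p2 x <= p2 y = (pos y <= pos x).
    move=> sxy; rewrite /p2; have [sy|sy] : side y = side x0 \/ side y = side y0.
      by rewrite s0; case: (side y); case: (side y0); auto.
      by rewrite -frow ?sxy // /flip sxy sy s0; case: (side y0).
    by rewrite flipE ?sxy // !frow' ?sxy.
  move=> nb; have [] := broken p2 rR cC r1 c1 (flip_convex _ (flip_convex _ lay)) srR sr1 scC sc1 _ _ nb.
  - by move=> x sx; rewrite !p2E ?sx // andbC r1m.
  - by move=> x sx; rewrite !p2E ?sx // andbC c1m.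
  - case=> t Gt Ht [l Gl Hl]; split.
      exists t => // b Gb; rewrite ltnNge -p2E ?(srow rR t) ?(srow r1 b) //.
      by rewrite -ltnNge Ht.
    exists l => // a Ga; rewrite ltnNge -p2E ?(scol cC l) ?(scol c1 a) //.
    by rewrite -ltnNge Hl.
have clash p x y (P Q : pred T) : P x -> Q y -> (forall b, Q b -> p b < p x) ->
    (forall t, P t -> p t < p y) -> False.
  by move=> Px Qy /(_ _ Qy) yx /(_ _ Px) /(ltn_trans yx); rewrite ltnn.
have clash' p x y (P Q : pred T) : P x -> Q y -> (forall b, Q b -> p x < p b) ->
    (forall t, P t -> p y < p t) -> False.
  by move=> Px Qy /(_ _ Qy) yx /(_ _ Px) /(ltn_trans yx); rewrite ltnn.
apply: contraT; rewrite negb_or !negb_and => /andP[/orP[/NW|/SE] h1 /orP[/NE|/SW] h2]; exfalso.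
- case: h1 h2 => _ [l Gl Hl] [_ [l' Gl' Hl']].
  exact: (clash pos l l' (G c1) (G cC)).
- case: h1 h2 => [[l Gl Hl] _] [[l' Gl' Hl'] _].
  exact: (clash pos l l' (G r1) (G rR)).
- case: h1 h2 => [[l Gl Hl] _] [[l' Gl' Hl'] _].
  exact: (clash' pos l l' (G rR) (G r1)).
- case: h1 h2 => _ [l Gl Hl] [_ [l' Gl' Hl']].
  exact: (clash' pos l l' (G cC) (G c1)).
Qed.

End Ends.

(** * Matchings and disjoint paths *)

Section Matching.

Variables (T : finType) (L R : {set T}) (E : rel T).
Variables (go : T -> option T) (h : T -> nat).

(* [go w = Some v] means that [w] in [R] is matched to [v] in [L]; the labels  *)
(* [h] are auction prices, and every matched vertex pays at most one more than *)
(* its cheapest option.                                                        *)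
Definition priced_matching :=
  [/\ forall w v, go w = Some v -> [/\ w \in R, v \in L & E v w],
      forall w w' v, go w = Some v -> go w' = Some v -> w = w',
      forall w, 0 < h w -> go w != None
    & forall w v w', go w = Some v -> w' \in R -> E v w' -> h w <= (h w').+1].

(** The bidder [v] takes its cheapest option [b] and thereby evicts the former owner. It pays at
    most one more than any other option, and for the other owners prices have only risen. The
    conclusion is [priced_matching] unfolded for [go'] and [h'], because inside the section that
    notion is tied to [go] and [h]. *)
Lemma bump_priced_matching v b (go' : T -> option T) (h' : T -> nat) :
  priced_matching -> v \in L -> (forall w, go w <> Some v) -> b \in R -> E v b ->
  (forall w, w \in R -> E v w -> h b <= h w) ->
  (forall w, go' w = if w == b then Some v else go w) ->
  (forall w, h' w = if w == b then (h b).+1 else h w) ->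
  [/\ forall w v, go' w = Some v -> [/\ w \in R, v \in L & E v w],
      forall w w' v, go' w = Some v -> go' w' = Some v -> w = w',
      forall w, 0 < h' w -> go' w != None
    & forall w v w', go' w = Some v -> w' \in R -> E v w' -> h' w <= (h' w').+1].
Proof.
move=> [gP ginj hpos hstep] vL nv bR Evb bmin g'E h'E.
have hh' w : h w <= h' w by rewrite h'E; case: eqP => [->|].
split.
- by move=> w v'; rewrite g'E; case: eqP => [-> [<-]|_ /gP].
- move=> w w' v'; rewrite !g'E; case: eqP => [->|_]; case: eqP => [->|_] //.
  + by move=> [<-] /nv.
  + by move=> e [ev]; case: (nv w); rewrite e ev.
  + exact: ginj.
- by move=> w; rewrite h'E g'E; case: eqP => // _ /hpos.
- move=> w v' w'; rewrite g'E h'E; case: eqP => [_ [<-] w'R Ew'|_ e w'R Ew'].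
    by rewrite ltnS (leq_trans (bmin _ w'R Ew')).
  by rewrite (leq_trans (hstep _ _ _ e w'R Ew')) // ltnS.
Qed.

Definition matched : {set T} := [set w | go w != None].

(* Some price level is unused; the vertices priced above it and their owners,  *)
(* together with the unmatched left vertices, are the worst case of Hall's     *)
(* condition.                                                                  *)
Lemma priced_matching_large d :
  priced_matching ->
  (forall v, v \in L -> (forall w, go w != Some v) ->
     forall w, w \in R -> E v w -> #|T| < h w) ->
  (forall Z : {set T}, Z \subset L ->
     #|Z| <= #|[set w in R | [exists v in Z, E v w]]| + d) ->
  #|L| <= #|matched| + d.
Proof.
move=> [gP ginj hpos hstep] stuck hall.
have [j jn jP] : exists2 j, j <= #|T| & forall w, h w != j.
  have [/existsP[j /forallP jP]|/existsPn N] :=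
    boolP [exists j : 'I_#|T|.+1, [forall w, h w != j]].
    by exists j => //; rewrite -ltnS.
  have cov (j : 'I_#|T|.+1) : exists w, h w == j.
    by have := N j; rewrite negb_forall => /existsP[w]; rewrite negbK; exists w.
  pose f (j : 'I_#|T|.+1) := xchoose (cov j).
  have finj : injective f.
    move=> a b eab; apply: val_inj => /=.
    by rewrite -(eqP (xchooseP (cov a))) -(eqP (xchooseP (cov b))) -/(f a) -/(f b) eab.
  by have := leq_card f finj; rewrite card_ord ltnn.
pose RJ := [set w | j < h w].
have RJm w : w \in RJ -> exists2 v, go w = Some v & v \in L.
  rewrite inE => jw; have := hpos w (leq_ltn_trans (leq0n j) jw).
  by case e: (go w) => [v|//] _; exists v => //; have [] := gP _ _ e.
pose im := [set v | [exists w, go w == Some v]].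
pose U := L :\: im.
pose ow := [set v | [exists w in RJ, go w == Some v]].
have owner w : w \in matched -> exists v, go w == Some v.
  by rewrite inE; case: (go w) => [v|] // _; exists v.
have card_img (W : {set T}) : W \subset matched ->
    #|[set v | [exists w in W, go w == Some v]]| = #|W|.
  move=> /subsetP sW; pose f w := odflt w (go w).
  rewrite -(card_in_imset (f := f) (D := mem W)).
    apply: eq_card => v; rewrite inE; apply/exists_inP/imsetP.
      by move=> [w wW /eqP e]; exists w => //; rewrite /f e.
    move=> [w wW ->]; exists w => //; have [v' /eqP e] := owner _ (sW _ wW).
    by rewrite /f e.
  move=> w w' wW w'W; rewrite /f.
  have [v /eqP e] := owner _ (sW _ wW); have [v' /eqP e'] := owner _ (sW _ w'W).
  by rewrite e e' /= => ev; apply: (ginj _ _ v); rewrite // e' ev.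
have RJsub : RJ \subset matched.
  by apply/subsetP=> w /RJm[v e _]; rewrite inE e.
have imcard : #|im| = #|matched|.
  rewrite -(card_img matched) //; apply: eq_card => v; rewrite !inE.
  apply/existsP/exists_inP => [[w e]|[w _ e]]; exists w => //.
  by rewrite inE (eqP e).
have imL : im \subset L.
  by apply/subsetP=> v; rewrite inE => /existsP[w /eqP /gP[]].
have Ucard : #|U| = #|L| - #|matched|.
  by rewrite cardsD (setIidPr imL) imcard.
have owL : ow \subset im.
  apply/subsetP=> v; rewrite !inE => /exists_inP[w _ e].
  by apply/existsP; exists w.
have ZL : ow :|: U \subset L.
  by rewrite subUset (subset_trans owL imL) subsetDl.
have dis : [disjoint ow & U].
  by rewrite disjoints_subset; apply/subsetP=> v /(subsetP owL) vim; rewrite inE in_setD vim.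
have := hall _ ZL; rewrite cardsU (disjoint_setI0 dis) cards0 subn0 card_img //.
(* An owner in [ow] pays more than [j] and at most one more than any of its options, so these cost
   at least [j], and more than [j] because no price equals [j]. A vertex of [U] sees only prices
   above [#|T|], hence above [j]. *)
have : #|[set w in R | [exists v in ow :|: U, E v w]]| <= #|RJ|.
  apply: subset_leq_card; apply/subsetP=> w'; rewrite !inE.
  case/andP=> w'R /exists_inP[v]; rewrite !inE => /orP[/exists_inP[w wRJ /eqP e]|].
    move=> Evw; have := hstep _ _ _ e w'R Evw; rewrite inE in wRJ => hw.
    by rewrite ltn_neqAle eq_sym jP /= -ltnS (leq_trans wRJ).
  case/andP=> /existsPn nv vL Evw; apply: leq_ltn_trans jn _.
  exact: stuck vL nv _ w'R Evw.
move=> h1 h2; have := leq_trans h2 (leq_add h1 (leqnn d)).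
by rewrite leq_add2l Ucard leq_subLR.
Qed.

End Matching.

(** * Disjoint walks along a partial injection *)

Section Paths.

Variables (T : finType) (G : sgraph T) (X Y : {set T}) (go : T -> option T).

(** A walk that has reached a vertex without image stays there, so that every walk can be iterated
    the same number of times. *)
Definition step w := odflt w (go w).

Hypothesis goP : forall w v, go w = Some v ->
  [/\ w \notin X, v \notin Y & (v == w) || G v w].
Hypothesis go_inj : forall w w' v, go w = Some v -> go w' = Some v -> w = w'.

Let N := #|T|.

Lemma step_some w v : go w = Some v -> step w = v.
Proof. by rewrite /step => ->. Qed.

Lemma step_none w : go w = None -> step w = w.
Proof. by rewrite /step => ->. Qed.

(** As [go] is injective, two walks that meet can be traced back together; the tracing ends at the
    starting points, since a vertex of [Y] is never an image. *)
Lemma iter_step_inj i j y y' : y \in Y -> y' \in Y ->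
  iter i step y = iter j step y' -> y = y'.
Proof.
move=> yY y'Y; elim: {i j}(i + j) {-2}i {-2}j (leqnn (i + j)) => [|m IHm] i j.
  by rewrite leqn0 addn_eq0 => /andP[/eqP-> /eqP->].
case: i => [|i]; case: j => [|j] //=.
- rewrite add0n ltnS => le.
  case e: (go (iter j step y')) => [v|]; last by rewrite (step_none e); apply: (IHm 0 j).
  by rewrite (step_some e) => h; have [_ /negP[]] := goP e; rewrite -h.
- rewrite addn0 ltnS => le.
  case e: (go (iter i step y)) => [v|].
    by rewrite (step_some e) => h; have [_ /negP[]] := goP e; rewrite h.
  by rewrite (step_none e); apply: (IHm i 0); rewrite ?addn0.
- rewrite addSn addnS ltnS => le.
  case e: (go (iter i step y)) => [v|]; last first.
    by rewrite (step_none e); apply: (IHm i j.+1); rewrite addnS.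
  case e': (go (iter j step y')) => [v'|]; last first.
    by rewrite (step_none e'); apply: (IHm i.+1 j); rewrite addSn.
  rewrite (step_some e) (step_some e') => h.
  apply: (IHm i j); first exact: leq_trans (leqnSn _) le.
  by apply: go_inj e _; rewrite h.
Qed.

(** The same backward tracing excludes repetitions before the walk stops; in particular a fixed
    point of [go] is never entered from [Y]. *)
Lemma iter_step_uniq i j y : y \in Y ->
  (forall m, m < maxn i j -> go (iter m step y) != None) ->
  iter i step y = iter j step y -> i = j.
Proof.
move=> yY; elim: i j => [|i IHi] [|j] //= alive.
- have := alive j; rewrite max0n ltnSn => /(_ isT).
  case e: (go _) => [v|] // _; rewrite (step_some e) => h.
  by have [_ /negP[]] := goP e; rewrite -h.
- have := alive i; rewrite maxn0 ltnSn => /(_ isT).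
  case e: (go _) => [v|] // _; rewrite (step_some e) => h.
  by have [_ /negP[]] := goP e; rewrite h.
rewrite maxnSS in alive.
have := alive i; rewrite ltnS leq_maxl => /(_ isT); have := alive j.
rewrite ltnS leq_maxr => /(_ isT).
case e: (go (iter j step y)) => [v|] // _; case e': (go (iter i step y)) => [v'|] // _.
rewrite (step_some e) (step_some e') => h.
congr _.+1; apply: IHi => [m le|]; first by apply: alive; apply: ltnW.
by apply: go_inj e' _; rewrite h.
Qed.

Lemma walk_stops y : y \in Y -> exists2 i, i < N & go (iter i step y) = None.
Proof.
move=> yY; have [/existsP[i /eqP e]|/existsPn alive] :=
  boolP [exists i : 'I_N, go (iter i step y) == None]; first by exists i.
have al m : m < N -> go (iter m step y) != None by move=> mN; apply: (alive (Ordinal mN)).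
have finj : injective (fun i : 'I_N.+1 => iter i step y).
  move=> a b /= eab; apply: val_inj; apply: iter_step_uniq eab => // m.
  rewrite leq_max => /orP[] lt; apply: al; apply: leq_trans lt _;
  by rewrite -ltnS.
by have := leq_card _ finj; rewrite card_ord ltnn.
Qed.

Definition walk y : {set T} := [set iter i step y | i : 'I_N].
Definition last_of y := iter N step y.

Lemma iter_stopped i j y : go (iter i step y) = None -> i <= j ->
  iter j step y = iter i step y.
Proof.
move=> e; elim: j => [|j IHj]; first by rewrite leqn0 => /eqP->.
rewrite leq_eqVlt => /orP[/eqP->//|]; rewrite ltnS => /IHj /= ->.
exact: step_none.
Qed.

Lemma walkP y : y \in Y ->
  [/\ y \in walk y, last_of y \in walk y, go (last_of y) = None &
      forall i, iter i step y \in walk y].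
Proof.
move=> yY; have [i0 i0N e] := walk_stops yY.
have mem i : iter i step y \in walk y.
  have [iN|Ni] := ltnP i N; first by apply/imsetP; exists (Ordinal iN).
  rewrite (iter_stopped e (leq_trans (ltnW i0N) Ni)).
  by apply/imsetP; exists (Ordinal i0N).
split=> //; [exact: (mem 0) | exact: mem |].
by rewrite /last_of (iter_stopped e (ltnW i0N)).
Qed.

Lemma walk_inj u y y' : y \in Y -> y' \in Y -> u \in walk y -> u \in walk y' -> y = y'.
Proof.
by move=> yY y'Y /imsetP[i _ ->] /imsetP[j _]; apply: iter_step_inj.
Qed.

Lemma walk_connected y : y \in Y -> connected_in G (walk y).
Proof.
move=> yY; have [_ _ _ mem] := walkP yY.
pose e := [rel a b | [&& a \in walk y, b \in walk y & G a b]].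
have es a : a \in walk y -> step a \in walk y -> connect e a (step a) && connect e (step a) a.
  case ea: (go a) => [v|] aw; last by rewrite (step_none ea) connect0.
  rewrite (step_some ea) => vw; have [_ _ /orP[/eqP->|Gva]] := goP ea; first by rewrite connect0.
  by rewrite !connect1 /e //= aw vw // adj_sym.
have from i : connect e y (iter i step y) && connect e (iter i step y) y.
  elim: i => [|i /andP[IH1 IH2]]; first by rewrite connect0.
  have /andP[h1 h2] := es _ (mem i) (mem i.+1).
  by rewrite (connect_trans IH1 h1) (connect_trans h2 IH2).
move=> u v /imsetP[i _ ->] /imsetP[j _ ->].
have /andP[_ h1] := from i; have /andP[h2 _] := from j.
exact: connect_trans h1 h2.
Qed.

Lemma walk_in_Y y u : y \in Y -> u \in walk y -> u \in Y -> u = y.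
Proof.
move=> yY /imsetP[i _ ->]; elim: (val i) => //= m IHm.
case e: (go (iter m step y)) => [v|]; last by rewrite (step_none e).
by rewrite (step_some e); have [_ /negPf->] := goP e.
Qed.

Lemma walk_in_X y u : y \in Y -> u \in walk y -> u \in X -> u = last_of y.
Proof.
move=> yY /imsetP[i _ ->] uX.
have e : go (iter i step y) = None.
  by case e: (go _) => [v|] //; have [] := goP e; rewrite uX.
by rewrite /last_of (iter_stopped e (ltnW (ltn_ord i))).
Qed.

Definition good : {set T} := [set y in Y | last_of y \in X].

Lemma walk_trivial y : y \in X -> walk y = [set y].
Proof.
move=> yX; have e : go y = None.
  by case e: (go _) => [v|] //; have [] := goP e; rewrite yX.
have N0 : 0 < N by rewrite /N; apply/card_gt0P; exists y.
apply/setP=> u; rewrite inE; apply/imsetP/eqP => [[i _ ->]|->].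
  by rewrite (@iter_stopped 0).
by exists (Ordinal N0).
Qed.

Lemma last_of_trivial y : y \in X -> last_of y = y.
Proof.
move=> yX; have e : go y = None.
  by case e: (go _) => [v|] //; have [] := goP e; rewrite yX.
by rewrite /last_of (@iter_stopped 0).
Qed.

(** Walks end at distinct vertices where [go] is undefined. There are [#|T| - #|matched go|] such
    vertices, among them all of [X], so at most [#|T| - #|matched go| - #|X|] walks end outside
    [X]. *)
Lemma card_good k : #|T| + k <= #|X| + #|Y| + #|matched go| -> k <= #|good|.
Proof.
move=> H; pose U := [set w | go w == None].
have cU : #|matched go| + #|U| = #|T|.
  rewrite -(cardsC (matched go)); congr (_ + _); apply: eq_card => w.
  by rewrite !inE negbK.
have XU : X \subset U.
  apply/subsetP=> x xX; rewrite inE; case e: (go x) => [v|] //.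
  by have [] := goP e; rewrite xX.
have linj : {in Y &, injective last_of}.
  by move=> y y' yY y'Y; apply: iter_step_inj.
have bad : #|Y :\: good| <= #|U :\: X|.
  rewrite -(card_in_imset (f := last_of)).
    apply: subset_leq_card; apply/subsetP=> u /imsetP[y].
    rewrite !inE => /andP[ng yY] ->; rewrite yY /= in ng.
    by rewrite ng; have [_ _ ->] := walkP yY.
  by apply: sub_in2 linj => y; rewrite inE => /andP[].
have sgY : good \subset Y by apply/subsetP=> y; rewrite inE => /andP[].
have := cardsID good Y; rewrite (setIidPr sgY) => eY.
have := cardsID X U; rewrite (setIidPr XU) => eU.
move: H; rewrite -cU -eY -eU.
by move: bad; lia.
Qed.

End Paths.

(** * Connectivity and colourings *)

Section Separation.

Variables (T : finType) (G : sgraph T) (k : nat).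
Hypothesis kG : k_connected G k.

(** A smaller neighbourhood would separate [v] from the remaining vertices, and some remain because
    there are more than [k] vertices. *)
Lemma k_connected_degree v : k <= #|nbhd G v|.
Proof.
have [kT cG] := kG; rewrite leqNgt; apply/negP => lt.
have /subsetPn[w _] : ~~ ([set: T] \subset v |: nbhd G v).
  apply/negP => /subset_leq_card; rewrite cardsT cardsU1; move: lt kT.
  by case: (v \in _) => /=; lia.
rewrite !inE => /norP[wv Gvw].
have vX : v \in ~: nbhd G v by rewrite !inE adj_irrefl.
have wX : w \in ~: nbhd G v by rewrite !inE.
case/negP: wv; apply: (connected_closed (P := pred1 v) (cG _ lt) vX wX) => //=.
by move=> a b _ bX Gab /eqP ea; move: bX; rewrite !inE -ea Gab.
Qed.

Lemma k_connected_connected : 0 < k -> connected_in G setT.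
Proof. by move=> k0; rewrite -setC0; apply: kG.2; rewrite cards0. Qed.

(** The set [W] of vertices outside [Z] that lie in [X] or next to [Z] cuts [Z] off. If it had fewer
    than [k] elements, some vertex of [X] would avoid it and thus lie in [Z], and some vertex of [Y]
    would avoid it and, by connectivity, lie in [Z] as well, although [Z] is disjoint from [Y]. The
    claim is [k <= #|W|] rewritten. *)
Lemma k_connected_hall (X Y Z : {set T}) :
  k <= #|X| -> k <= #|Y| -> Z \subset ~: Y ->
  #|Z| <= #|[set w in ~: X | [exists v in Z, (v == w) || G v w]]| + (#|X| - k).
Proof.
move=> kX kY /subsetP ZY; set NZ := [set w in _ | _].
pose W := (NZ :|: X) :\: Z.
have ZNX : Z \subset NZ :|: X.
  apply/subsetP=> z zZ; rewrite !inE; case: (z \in X); rewrite ?orbT //= orbF.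
  by apply/exists_inP; exists z; rewrite ?eqxx.
have cNX : #|NZ :|: X| = #|NZ| + #|X|.
  rewrite cardsU; have -> : NZ :&: X = set0 by apply/setP=> w; rewrite !inE; case: (w \in X); rewrite ?andbF.
  by rewrite cards0 subn0.
have cW : #|W| = #|NZ| + #|X| - #|Z| by rewrite cardsD (setIidPr ZNX) cNX.
suff kW : k <= #|W| by move: kW; have := subset_leq_card ZNX; lia.
rewrite leqNgt; apply/negP => lt; have cS := kG.2 _ lt.
have pick (U : {set T}) : k <= #|U| -> exists2 u, u \in U & u \in ~: W.
  move=> kU; have /subsetPn[u uU uW] : ~~ (U \subset W).
    by apply/negP => /subset_leq_card; rewrite leqNgt (leq_trans lt kU).
  by exists u; rewrite ?inE // in uW *.
have [x xX xW] := pick _ kX; have [y yY yW] := pick _ kY.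
have xZ : x \in Z by move: xW; rewrite !inE xX orbT andbT negbK.
have : y \in Z.
  apply: (connected_closed (P := mem Z) cS xW yW xZ) => u v _ vW Guv uZ.
  have: v \in NZ :|: X.
    rewrite !inE; case: (v \in X); rewrite ?orbT //= orbF.
    by apply/exists_inP; exists u; rewrite ?Guv ?orbT.
  by move=> vN; move: vW; rewrite inE in_setD vN andbT negbK.
by move/ZY; rewrite inE yY.
Qed.

End Separation.

(** * Attaching free vertices to coloured classes *)

Section Attach.

Variables (T : finType) (G : sgraph T) (k : nat).

Definition cls (col : T -> nat) i := [set u | col u == i].

(** Colour 0 marks the free vertices. The last condition makes the colours in each of the four
    neighbourhoods distinct, which is what leaves free vertices there. *)
Definition partial_coloring r r' c c' (col : T -> nat) :=
  [/\ forall u, col u <= k,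
      forall i, 0 < i <= k -> connected_in G (cls col i),
      forall i, 0 < i <= k -> hits G (cls col i) r || hits G (cls col i) c,
      forall i, 0 < i <= k -> hits G (cls col i) r' || hits G (cls col i) c'
    & forall z u v, z \in [:: r; r'; c; c'] -> G z u -> G z v ->
        col u = col v -> 0 < col u -> u = v].

(** A free vertex given to colour [i] for the sake of [z] must not become a second vertex of colour
    [i] next to [z']. Both alternatives prevent this: either no free vertex is adjacent to both, or
    a colour above [m], hence not yet treated, that misses one neighbourhood misses the other. *)
Definition balanced z z' m (col : T -> nat) :=
  (forall u, G z u -> G z' u -> 0 < col u) \/
  forall i, m < i <= k -> hits G (cls col i) z = hits G (cls col i) z'.

Definition paint (col : T -> nat) u i v := if v == u then i else col v.

Lemma eq_cls col col' : col =1 col' -> cls col =1 cls col'.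
Proof. by move=> e i; apply/setP=> u; rewrite !inE e. Qed.

Lemma eq_partial_coloring r r' c c' col col' : col =1 col' ->
  partial_coloring r r' c c' col -> partial_coloring r r' c c' col'.
Proof.
move=> e [h1 h2 h3 h4 h5]; split.
- by move=> u; rewrite -e.
- by move=> i; rewrite -(eq_cls e); apply: h2.
- by move=> i; rewrite -(eq_cls e); apply: h3.
- by move=> i; rewrite -(eq_cls e); apply: h4.
- by move=> z u v; rewrite -!e; apply: h5.
Qed.

Lemma partial_coloring_swap r r' c c' col :
  partial_coloring r r' c c' col -> partial_coloring c c' r r' col.
Proof.
move=> [h1 h2 h3 h4 h5]; split=> //.
- by move=> i /h3; rewrite orbC.
- by move=> i /h4; rewrite orbC.
- move=> z u v zin; apply: h5; move: zin; rewrite !inE.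
  by case/or4P=> ->; rewrite ?orbT.
Qed.

Lemma partial_coloring_rev r r' c c' col :
  partial_coloring r r' c c' col -> partial_coloring r' r c' c col.
Proof.
move=> [h1 h2 h3 h4 h5]; split=> //.
move=> z u v zin; apply: h5; move: zin; rewrite !inE.
by case/or4P=> ->; rewrite ?orbT.
Qed.

Lemma compatible_swap r r' c c' : compatible G r r' c c' -> compatible G c c' r r'.
Proof.
case=> h1 h2 h3 h4; split=> //.
- by move=> u v Gu Gv; rewrite adj_sym h1.
- by move=> u v Gu Gv; rewrite adj_sym h2.
Qed.

Lemma compatible_rev r r' c c' : compatible G r r' c c' -> compatible G r' r c' c.
Proof.
case=> h1 h2 h3 h4; split=> // u; first by apply: contraL; apply: h4.
by apply: contraL; apply: h3.
Qed.

(** If all neighbours of [z] were coloured, their colours together with [i] would be more than [k]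
    distinct numbers from 1 to [k]. *)
Lemma uncolored_neighbor r r' c c' col z i :
  partial_coloring r r' c c' col -> z \in [:: r; r'; c; c'] -> k <= #|nbhd G z| ->
  0 < i <= k -> ~~ hits G (cls col i) z -> exists2 u, G z u & col u = 0.
Proof.
move=> [h1 _ _ _ h5] zin kz ik nh.
have [/exists_inP[u zu /eqP e]|/exists_inPn all] :=
  boolP [exists u in nbhd G z, col u == 0].
  by exists u => //; rewrite inE in zu.
have pos u : G z u -> 0 < col u by move=> zu; rewrite lt0n all ?inE.
pose s := [seq col u | u <- enum (nbhd G z)].
suff : size (i :: s) <= size (iota 1 k).
  by rewrite size_iota /= size_map -cardE ltnNge kz.
apply: uniq_leq_size.
  rewrite /= map_inj_in_uniq ?enum_uniq ?andbT.
    apply/negP => /mapP[u]; rewrite mem_enum inE => zu e; case/negP: nh.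
    by apply/exists_inP; exists u; rewrite ?inE ?e.
  by move=> u v; rewrite !mem_enum !inE => zu zv e; apply: (h5 z) => //; apply: pos.
move=> j; rewrite inE mem_iota => /orP[/eqP->|]; first by rewrite add1n ltnS.
by case/mapP=> u; rewrite mem_enum inE => zu ->; rewrite pos //= add1n ltnS h1.
Qed.

Lemma hits_paint col u i j z : col u = 0 -> 0 < j ->
  hits G (cls (paint col u i) j) z = hits G (cls col j) z || (j == i) && G z u.
Proof.
move=> cu j0; apply/exists_inP/orP => [[v]|[/exists_inP[v]|/andP[/eqP-> zu]]].
- rewrite inE /paint; case: (eqVneq v u) => [->|_] e zv.
    by right; rewrite eq_sym e zv.
  by left; apply/exists_inP; exists v; rewrite ?inE.
- rewrite inE => /eqP e zv; exists v; rewrite // inE /paint.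
  case: (eqVneq v u) => [ev|_]; last by rewrite e.
  by move: j0; rewrite -e ev cu.
- by exists u; rewrite // inE /paint !eqxx.
Qed.

(** Class [i] misses the neighbourhood of [r], hence meets that of [c], all of which is adjacent to
    [u]. Compatibility keeps [u] away from [c] and [c']: a common neighbour of [r] and [c] would be
    adjacent to itself. *)
Lemma paint_partial_coloring r r' c c' col u i :
  compatible G r r' c c' -> partial_coloring r r' c c' col -> 0 < i <= k ->
  col u = 0 -> G r u -> ~~ hits G (cls col i) r ->
  (G r' u -> ~~ hits G (cls col i) r') ->
  partial_coloring r r' c c' (paint col u i).
Proof.
move=> [b1 b2 d1 d2] [h1 h2 h3 h4 h5] ik cu ru nr nr'; split.
- by move=> v; rewrite /paint; case: eqP => // _; case/andP: ik.
- move=> j jk; have j0 : 0 < j by case/andP: jk.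
  have [->|ji] := eqVneq j i.
    have := h3 i ik; rewrite (negPf nr) => /exists_inP[w wi cw].
    have -> : cls (paint col u i) i = u |: cls col i.
      by apply/setP=> v; rewrite !inE /paint; case: (v == u); rewrite ?eqxx.
    by apply: connected_inU1 (h2 i ik) wi (b1 _ _ ru cw).
  have -> : cls (paint col u i) j = cls col j; last exact: h2.
  apply/setP=> v; rewrite !inE /paint; case: (eqVneq v u) => [->|//].
  by rewrite cu eq_sym (negPf ji) eq_sym; case: (j) j0.
- by move=> j jk; have [j0 _] := andP jk; rewrite !hits_paint //;
     case/orP: (h3 j jk) => ->; rewrite ?orbT.
- by move=> j jk; have [j0 _] := andP jk; rewrite !hits_paint //;
     case/orP: (h4 j jk) => ->; rewrite ?orbT.
have uc z : z \in [:: r; r'; c; c'] -> G z u -> ~~ hits G (cls col i) z.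
  rewrite !inE => /or4P[] /eqP-> // zu; exfalso.
    by have := b1 _ _ ru zu; rewrite adj_irrefl.
  by case/negP: (d1 _ ru).
move=> z v w zin zv zw; rewrite /paint.
have nope x : G z x -> G z u -> col x = i -> False.
  move=> zx zu e; case/negP: (uc z zin zu); apply/exists_inP.
  by exists x; rewrite ?inE ?e.
case: (eqVneq v u) => [ev|_]; case: (eqVneq w u) => [ew|_]; rewrite ?ev ?ew //.
- by move=> e _; case: (nope w); rewrite -?ev.
- by move=> e _; case: (nope v); rewrite -?ew.
- exact: h5 zin zv zw.
Qed.

(** Common neighbours are preferred so that, if colour [i] still misses [z'] afterwards, no free
    common neighbour is left to spoil the attachment for [z']. The last alternative, in which [col']
    is unconstrained, is excluded by [uncolored_neighbor]. *)
Definition picked z z' i (col col' : T -> nat) :=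
  if hits G (cls col i) z then col' =1 col else
  (exists u, [/\ col u = 0, G z u, col' =1 paint col u i &
     G z' u \/ forall v, G z v -> G z' v -> 0 < col v]) \/
  (forall u, G z u -> 0 < col u).

Lemma attach_step r r' c c' col col1 col2 i :
  compatible G r r' c c' -> (forall v, k <= #|nbhd G v|) ->
  partial_coloring r r' c c' col -> 0 < i <= k -> balanced r r' i.-1 col ->
  picked r r' i col col1 -> picked r' r i col1 col2 ->
  [/\ partial_coloring r r' c c' col2,
      forall u, 0 < col u -> col2 u = col u,
      hits G (cls col2 i) r && hits G (cls col2 i) r',
      forall j z, 0 < j -> j != i -> hits G (cls col2 j) z = hits G (cls col j) z &
      forall j z, 0 < j -> z \in [:: c; c'] -> hits G (cls col2 j) z = hits G (cls col j) z].
Proof.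
move=> cpt deg pc ik bal p1 p2; have [b1 b2 d1 d2] := cpt.
have i0 : 0 < i by case/andP: ik.
have nocc u z : G r u \/ G r' u -> z \in [:: c; c'] -> ~~ G z u.
  rewrite !inE => ru /orP[] /eqP->; case: ru => [ru|ru].
  - by apply/negP => cu; have := b1 _ _ ru cu; rewrite adj_irrefl.
  - by apply/negP => /d2; rewrite ru.
  - exact: d1.
  - by apply/negP => cu; have := b2 _ _ ru cu; rewrite adj_irrefl.
have [pc1 mono1 hr1 [bal1 other1 cc1]] :
  [/\ partial_coloring r r' c c' col1, forall u, 0 < col u -> col1 u = col u,
      hits G (cls col1 i) r &
     [/\ ~~ hits G (cls col1 i) r' -> forall u, G r u -> G r' u -> 0 < col1 u,
      forall j z, 0 < j -> j != i -> hits G (cls col1 j) z = hits G (cls col j) z &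
      forall j z, 0 < j -> z \in [:: c; c'] -> hits G (cls col1 j) z = hits G (cls col j) z]].
  move: p1; rewrite /picked; case hr: (hits _ _ r).
    move=> e; have ec := eq_cls e; split.
    - by apply: eq_partial_coloring pc => u; rewrite e.
    - by move=> u; rewrite e.
    - by rewrite ec.
    - split=> [|j z _ _|j z _ _]; rewrite ec //.
      case: bal => [b _ u ru r'u|b]; first by rewrite e b.
      by rewrite -(b i) ?hr // prednK // leqnn; case/andP: ik.
  have nhr := negbT hr; case=> [[u [cu ru e pref]]|full]; last first.
    have [|u ru cu] := uncolored_neighbor pc _ (deg r) ik nhr; rewrite ?inE ?eqxx //.
    by have := full _ ru; rewrite cu.
  have ec := eq_cls e.
  have r'ok : G r' u -> ~~ hits G (cls col i) r'.
    move=> r'u; case: bal => [b|b]; first by have := b _ ru r'u; rewrite cu.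
    by rewrite -(b i) // prednK // leqnn; case/andP: ik.
  split.
  - apply: (eq_partial_coloring (col := paint col u i)); first by move=> v; rewrite e.
    exact: paint_partial_coloring.
  - by move=> v v0; rewrite e /paint; case: eqP => // ev; rewrite ev cu in v0.
  - by rewrite ec hits_paint // ru eqxx orbT.
  - split=> [|j z j0 ji|j z j0 zc].
    + rewrite ec hits_paint // eqxx /= => /norP[_ nr'u] v rv r'v.
      case: pref => [r'u|/(_ v rv r'v) v0]; first by rewrite r'u in nr'u.
      by rewrite e /paint; case: eqP => // ev; rewrite ev (negPf nr'u) in r'v.
    + by rewrite ec hits_paint // (negPf ji) orbF.
    + by rewrite ec hits_paint // (negPf (nocc u z _ zc)) ?andbF ?orbF //; left.
move: p2; rewrite /picked; case hr': (hits _ _ r').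
  move=> e; have ec := eq_cls e; split.
  - by apply: eq_partial_coloring pc1 => u; rewrite e.
  - by move=> u u0; rewrite e mono1.
  - by rewrite ec hr1 hr'.
  - by move=> j z j0 ji; rewrite ec other1.
  - by move=> j z j0 ji; rewrite ec cc1.
have nhr := negbT hr'; case=> [[u [cu ru e _]]|full]; last first.
  have [|u ru cu] := uncolored_neighbor pc1 _ (deg r') ik nhr; rewrite ?inE ?eqxx ?orbT //.
  by have := full _ ru; rewrite cu.
have ec := eq_cls e; split.
- apply: (eq_partial_coloring (col := paint col1 u i)); first by move=> v; rewrite e.
  apply: partial_coloring_rev; apply: paint_partial_coloring => //.
  + exact: compatible_rev.
  + exact: partial_coloring_rev.
  + by move=> r0u; have := bal1 nhr _ r0u ru; rewrite cu.
- move=> v v0; rewrite e /paint mono1 //; case: eqP => // ev.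
  by move: cu; rewrite -ev mono1 // => cv; rewrite cv in v0.
- by rewrite ec !hits_paint // ru eqxx hr1 orbT.
- by move=> j z j0 ji; rewrite ec hits_paint // (negPf ji) orbF other1.
- by move=> j z j0 zc; rewrite ec hits_paint // (negPf (nocc u z _ zc)) ?andbF ?orbF ?cc1 //; right.
Qed.

End Attach.

(** * Loop programs *)

(* Programs whose only loops run over the indices below [n] (held in cell 0 of *)
(* array 0), with the loop counter in cell 0 of the array [a] of [LFor a]:      *)
(* they are total, and their running time is polynomial by construction.       *)
Inductive loop :=
| LSkip
| LWrite of nat & expr & expr
| LSeq of loop & loop
| LIf of expr & loop & loop
| LFor of nat & loop.

Fixpoint compile (p : loop) : prog :=
  match p with
  | LSkip => Skip
  | LWrite a i x => Write a i x
  | LSeq p q => Seq (compile p) (compile q)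
  | LIf x p q => If x (compile p) (compile q)
  | LFor a p =>
      Seq (Write a (Const 0) (Const 0))
        (While (Defs.Sub (Read 0 (Const 0)) (Read a (Const 0)))
           (Seq (compile p)
              (Write a (Const 0) (Add (Read a (Const 0)) (Const 1)))))
  end.

Fixpoint sem (p : loop) (s : store) : store :=
  match p with
  | LSkip => s
  | LWrite a i x => update s a (eval s i) (eval s x)
  | LSeq p q => sem q (sem p s)
  | LIf x p q => if eval s x != 0 then sem p s else sem q s
  | LFor a p =>
      iter (s 0 0) (fun s => update (sem p s) a 0 (sem p s a 0 + 1)) (update s a 0 0)
  end.

Fixpoint writes (p : loop) : seq nat :=
  match p with
  | LSkip => [::]
  | LWrite a _ _ => [:: a]
  | LSeq p q | LIf _ p q => writes p ++ writes q
  | LFor a p => a :: writes p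
  end.

Fixpoint wf (p : loop) : bool :=
  match p with
  | LSkip => true
  | LWrite a _ _ => a != 0
  | LSeq p q | LIf _ p q => wf p && wf q
  | LFor a p => [&& a != 0, a \notin writes p & wf p]
  end.

(** In a loop, each round pays 2 for the test and the increment, and the final 2 is for the reset of
    the counter and the failing test. Adding both branches of a conditional, instead of taking the
    maximum, keeps the bound a polynomial. *)
Fixpoint cost (p : loop) (n : nat) : nat :=
  match p with
  | LSkip | LWrite _ _ _ => 1
  | LSeq p q => cost p n + cost q n
  | LIf _ p q => (cost p n + cost q n).+1
  | LFor _ p => (n * (cost p n + 2)).+2
  end.

Lemma sem_frame p b j s : b \notin writes p -> sem p s b j = s b j.
Proof.
elim: p s => //= [a i x|p IHp q IHq|x p IHp q IHq|a p IHp] s.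
- by rewrite inE /update => /negPf->.
- by rewrite mem_cat negb_or => /andP[pb qb]; rewrite IHq ?IHp.
- by rewrite mem_cat negb_or => /andP[pb qb]; case: ifP => _; auto.
- rewrite inE negb_or => /andP[/negPf ba pb].
  by elim: (s 0 0) => [|m IHm] /=; rewrite /update ba //= IHp.
Qed.

Lemma wf_writes p : wf p -> 0 \notin writes p.
Proof.
elim: p => //= [a _ _|p IHp q IHq|_ p IHp q IHq|a p IHp].
- by rewrite inE eq_sym.
- by move=> /andP[/IHp ? /IHq ?]; rewrite mem_cat negb_or; apply/andP.
- by move=> /andP[/IHp ? /IHq ?]; rewrite mem_cat negb_or; apply/andP.
- by case/and3P=> a0 _ /IHp ?; rewrite inE negb_or eq_sym a0.
Qed.

Lemma compile_correct p s : wf p ->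
  exists2 t, exec (compile p) s t (sem p s) & t <= cost p (s 0 0).
Proof.
elim: p s => /= [|a i x|p IHp q IHq|x p IHp q IHq|a p IHp] s.
- by exists 1 => //; constructor.
- by exists 1 => //; constructor.
- case/andP=> wp wq; have [t1 e1 c1] := IHp s wp; have [t2 e2 c2] := IHq (sem p s) wq.
  exists (t1 + t2); first exact: ExecSeq e1 e2.
  by rewrite leq_add // -(@sem_frame p 0 0 s) // wf_writes.
- case/andP=> wp wq; case: ifPn => [nz|]; last rewrite negbK => /eqP z.
  - have [t e c] := IHp s wp; exists t.+1; first exact: ExecIfTrue.
    by rewrite ltnS (leq_trans c) ?leq_addr.
  - have [t e c] := IHq s wq; exists t.+1; first exact: ExecIfFalse.
    by rewrite ltnS (leq_trans c) ?leq_addl.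
case/and3P=> a0 ap wp; set n := s 0 0.
pose f s := update (sem p s) a 0 (sem p s a 0 + 1).
have p0 := wf_writes wp.
have a0' : (0 == a) = false by rewrite eq_sym (negPf a0).
suff H m u : u 0 0 = n -> u a 0 + m = n -> exists2 t,
    exec (While (Defs.Sub (Read 0 (Const 0)) (Read a (Const 0)))
           (Seq (compile p) (Write a (Const 0) (Add (Read a (Const 0)) (Const 1)))))
         u t (iter m f u) & t <= (m * (cost p n + 2)).+1.
  have [||t e c] := H n (update s a 0 0).
  - by rewrite /update a0'.
  - by rewrite /update !eqxx.
  exists (1 + t); last by rewrite add1n ltnS.
  by apply: ExecSeq e; apply: (ExecWrite a (Const 0) (Const 0)).
elim: m u => [|m IHm] u un um.
  exists 1 => //; apply: ExecWhileFalse => /=.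
  by move: um; rewrite addn0 un => ->; apply: subnn.
have [t1 e1 c1] := IHp u wp.
have pa : sem p u a 0 = u a 0 by rewrite sem_frame.
have [||t2 e2 c2] := IHm (f u).
- by rewrite /f /update a0' /= sem_frame.
- by rewrite /f /update !eqxx pa addn1 addSnnS.
exists ((t1 + 1) + t2).+1.
  rewrite iterSr; apply: ExecWhileTrue e2.
    by rewrite /= un -um; lia.
  by apply: ExecSeq e1 _; apply: (ExecWrite a (Const 0) (Add _ _)).
by move: c1 c2; rewrite un mulSn; lia.
Qed.

Lemma cost_poly p : exists c d, forall n, 0 < n -> cost p n <= c * n ^ d.
Proof.
have up n c d d' : 0 < n -> c * n ^ d <= c * n ^ (d + d').
  by move=> n0; rewrite leq_mul2l leq_pexp2l ?leq_addr ?orbT.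
have two n c1 d1 c2 d2 : 0 < n -> c1 * n ^ d1 + c2 * n ^ d2 <= (c1 + c2) * n ^ (d1 + d2).
  by move=> n0; rewrite mulnDl leq_add ?up // addnC up.
have one n d : 0 < n -> 1 <= n ^ d by move=> n0; rewrite expn_gt0 n0.
elim: p => /= [||p [c1 [d1 IHp]] q [c2 [d2 IHq]]|_ p [c1 [d1 IHp]] q [c2 [d2 IHq]]|_ p [c [d IHp]]].
- by exists 1, 0.
- by move=> *; exists 1, 0.
- exists (c1 + c2), (d1 + d2) => n n0.
  exact: leq_trans (leq_add (IHp n n0) (IHq n n0)) (two _ _ _ _ _ n0).
- exists (c1 + c2).+1, (d1 + d2) => n n0; rewrite mulSn -add1n leq_add ?one //.
  exact: leq_trans (leq_add (IHp n n0) (IHq n n0)) (two _ _ _ _ _ n0).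
(* The 4 absorbs the overhead of the loop: [2 * n + 2 <= 4 * n]. *)
- exists (c + 4), (d.+1) => n n0; rewrite mulnDl expnS.
  have := IHp n n0; have := one n d n0; move: (n ^ d) (cost p n) => D C; nia.
Qed.

(** The invariant rule. The body may also assume that the arrays outside [a :: writes p] are as at
    the start, so that [I] need only speak of what changes. *)
Lemma sem_for (I : nat -> store -> Prop) a p s0 n :
  wf (LFor a p) -> s0 0 0 = n -> I 0 (update s0 a 0 0) ->
  (forall i s, i < n -> s a 0 = i -> (forall b j, b \notin a :: writes p -> s b j = s0 b j) ->
     I i s -> I i.+1 (update (sem p s) a 0 i.+1)) ->
  I n (sem (LFor a p) s0).
Proof.
move=> /= /and3P[a0 ap wp] n0 I0 IS; rewrite n0.
pose f s := update (sem p s) a 0 (sem p s a 0 + 1).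
suff H m : m <= n -> [/\ I m (iter m f (update s0 a 0 0)), iter m f (update s0 a 0 0) a 0 = m &
    forall b j, b \notin a :: writes p -> iter m f (update s0 a 0 0) b j = s0 b j].
  by have [] := H n (leqnn n).
elim: m => [|m IHm] mn.
  split; first exact: I0.
  - by rewrite /= /update !eqxx.
  - by move=> b j; rewrite inE negb_or /= /update => /andP[/negPf-> _].
have [Im cm fm] := IHm (ltnW mn); rewrite iterS; move: (iter m f _) Im cm fm => s Im cm fm.
have e : sem p s a 0 + 1 = m.+1 by rewrite sem_frame // cm addn1.
split; first by rewrite /f e; apply: IS.
- by rewrite /f /update !eqxx e.
- move=> b j bn; rewrite -(fm b j bn); move: bn; rewrite inE negb_or => /andP[/negPf ba pb].
  by rewrite /f /update ba /= sem_frame.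
Qed.

(** * The program *)

(* Memory map: arrays 0, 1 and 2 are fixed by the model; 3 holds the offsets of *)
(* the rows of the adjacency matrix; 4 and 5 the owner and the price of each    *)
(* vertex in the auction; 6 and 7 the membership in X and Y.  The others are    *)
(* variables: 8 failure and 9 success; 10 to 13 the guess r, r', c, c'; 16 the  *)
(* current bidder, 17 the best candidate, 18 the evicted owner; 23 the number   *)
(* of colours used; 24 the position on a walk; 25 the outcome of a search; 14,  *)
(* 15 and 19 to 22 loop counters.  In 4, 16, 17 and 18 vertices are shifted by  *)
(* one, 0 meaning that there is none.                                           *)
Notation "p ;; q" := (LSeq p q) (at level 60, right associativity).

Definition Var a := Read a (Const 0).
Definition Set_ a x := LWrite a (Const 0) x.
Definition Succ x := Add x (Const 1).
Definition Pred x := Defs.Sub x (Const 1).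
Definition Diff x y := Add (Defs.Sub x y) (Defs.Sub y x).
Definition N_ := Read 0 (Const 0).
Definition K_ := Read 0 (Const 1).
Definition When x p := LIf x p LSkip.
Definition Unless x p := LIf x LSkip p.

(** The offset of the row is looked up because the machine cannot multiply. *)
Definition Adj x y := Read 1 (Add (Read 3 x) y).

Lemma sem_skip s : sem LSkip s = s. Proof. by []. Qed.
Lemma sem_write a i x s : sem (LWrite a i x) s = update s a (eval s i) (eval s x).
Proof. by []. Qed.
Lemma sem_seq p q s : sem (LSeq p q) s = sem q (sem p s). Proof. by []. Qed.
Lemma sem_if x p q s : sem (LIf x p q) s = if eval s x != 0 then sem p s else sem q s.
Proof. by []. Qed.
Lemma sem_when x p s : sem (When x p) s = if eval s x != 0 then sem p s else s.
Proof. by []. Qed.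
Lemma sem_unless x p s : sem (Unless x p) s = if eval s x != 0 then s else sem p s.
Proof. by []. Qed.
Lemma sem_set a x s : sem (Set_ a x) s = update s a 0 (eval s x).
Proof. by []. Qed.
Definition semE :=
  (sem_skip, sem_set, sem_write, sem_seq, sem_when, sem_unless, sem_if).
Arguments sem : simpl never.

Lemma diff_eq0 a b : (a - b + (b - a) != 0) = (a != b).
Proof. lia. Qed.

Lemma for_exists a p f s0 n (Q : pred 'I_n) :
  wf (LFor a p) -> f != a -> s0 0 0 = n ->
  (forall (i : 'I_n) (s : store), s a 0 = i ->
     (forall b j, b \notin a :: writes p -> s b j = s0 b j) ->
     (sem p s f 0 != 0) = (s f 0 != 0) || Q i) ->
  (sem (LFor a p) s0 f 0 != 0) = (s0 f 0 != 0) || [exists i, Q i].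
Proof.
move=> w fa n0 H.
have -> : [exists i, Q i] = [exists j : 'I_n, (j < n) && Q j].
  by apply: eq_existsb => j; rewrite ltn_ord.
apply: (sem_for (I := fun i s =>
  (s f 0 != 0) = (s0 f 0 != 0) || [exists j : 'I_n, (j < i) && Q j])) n0 _ _ => //.
  by rewrite /update (negPf fa) /=; case: existsP => [[j //]|]; rewrite ?orbF.
move=> i s lt sa fr e; rewrite /update (negPf fa) /= (H (Ordinal lt)) // e -orbA; congr orb.
apply/orP/existsP => [[/existsP[j /andP[ji Qj]]|Qi]|[j /andP[]]].
- by exists j; rewrite Qj ltnS ltnW.
- by exists (Ordinal lt); rewrite /= Qi ltnSn.
- rewrite ltnS leq_eqVlt => /orP[/eqP ej Qj|ji Qj]; last first.
    by left; apply/existsP; exists j; rewrite ji.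
  by right; rewrite (_ : Ordinal lt = j) //; apply: val_inj.
Qed.

Lemma for_find a p f s0 n (Q : pred 'I_n) :
  wf (LFor a p) -> f != a -> s0 0 0 = n ->
  (forall (i : 'I_n) (s : store), s a 0 = i ->
     (forall b j, b \notin a :: writes p -> s b j = s0 b j) ->
     sem p s f 0 = if Q i then i.+1 else s f 0) ->
  let s := sem (LFor a p) s0 in
  (exists2 i, Q i & s f 0 = i.+1) \/ (forall i, ~~ Q i) /\ s f 0 = s0 f 0.
Proof.
move=> w fa n0 H.
have := @sem_for (fun i s => (exists2 i, Q i & s f 0 = i.+1) \/
  (forall j : 'I_n, j < i -> ~~ Q j) /\ s f 0 = s0 f 0) a p s0 n w n0.
case=> [|i s lt sa fr IH|[i Qi e]|[nQ e]].
- by right; split=> //; rewrite /update (negPf fa).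
- rewrite /update (negPf fa) /= (H (Ordinal lt)) //; case: ifPn => Qi.
    by left; exists (Ordinal lt).
  case: IH => [[j Qj e]|[nQ e]]; first by left; exists j.
  right; split=> // j; rewrite ltnS leq_eqVlt => /orP[/eqP ej|]; last exact: nQ.
  by rewrite (_ : j = Ordinal lt) //; apply: val_inj.
- by left; exists i; rewrite // e.
- by right; split=> // j; apply: nQ.
Qed.

(** Truth values are 0 and 1. [Not] and [Eq] are right for all numbers, [And] only for truth
    values. *)
Definition Not x := Defs.Sub (Const 1) x.
Definition Eq x y := Not (Diff x y).
Definition And x y := Pred (Add x y).

Lemma eval_Not s x : eval s (Not x) = (eval s x == 0).
Proof. by rewrite /=; case: (eval s x) => [|m] //=; rewrite subSS. Qed.

Lemma eval_Eq s x y : eval s (Eq x y) = (eval s x == eval s y).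
Proof. by rewrite eval_Not /= -[_ == 0]negbK diff_eq0 negbK. Qed.

Lemma eval_And s x y (a b : bool) : eval s x = a -> eval s y = b -> eval s (And x y) = a && b.
Proof. by move=> /= -> ->; case: a; case: b. Qed.

Definition Exists a f e := Set_ f (Const 0) ;; LFor a (When e (Set_ f (Const 1))).
(** A search without success leaves the cell unchanged, so searches can be chained in order of
    increasing preference. *)
Definition Find a f e := LFor a (When e (Set_ f (Succ (Var a)))).

Lemma ExistsP a f e s n (Q : pred 'I_n) :
  a != 0 -> f != 0 -> f != a -> s 0 0 = n ->
  (forall (i : 'I_n) (t : store), t a 0 = i ->
     (forall b j, b \notin [:: a; f] -> t b j = s b j) -> eval t e = Q i) ->
  (sem (Exists a f e) s f 0 != 0) = [exists i, Q i].
Proof.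
move=> a0 f0 fa s0 H; rewrite sem_seq sem_set.
rewrite (@for_exists _ _ f _ n Q) //=.
- by rewrite /update !eqxx.
- by rewrite inE a0 eq_sym fa f0.
- by rewrite /update eq_sym (negPf f0).
move=> i t ti fr; rewrite sem_when (H i) //.
  by rewrite eqb0 negbK sem_set; case: (Q i); rewrite ?orbF //= /update !eqxx orbT.
move=> b j; rewrite !inE negb_or => /andP[ba bf].
by rewrite fr ?inE ?negb_or ?ba //= /update (negPf bf).
Qed.

Lemma FindP a f e s n (Q : pred 'I_n) :
  a != 0 -> f != 0 -> f != a -> s 0 0 = n ->
  (forall (i : 'I_n) (t : store), t a 0 = i ->
     (forall b j, b \notin [:: a; f] -> t b j = s b j) -> eval t e = Q i) ->
  (exists2 i, Q i & sem (Find a f e) s f 0 = i.+1) \/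
  (forall i, ~~ Q i) /\ sem (Find a f e) s f 0 = s f 0.
Proof.
move=> a0 f0 fa s0 H; apply: for_find => //=.
  by rewrite inE a0 eq_sym fa f0.
move=> i t ti fr; rewrite sem_when (H i) //.
by rewrite eqb0 negbK sem_set; case: (Q i); rewrite //= /update !eqxx ti addn1.
Qed.

(** * Compatibility test, attachment and domination test as programs *)

Section Pieces.

Variables (n k : nat) (G : sgraph 'I_n).

Definition env (s : store) :=
  [/\ s 0 0 = n, s 0 1 = k & forall u v : 'I_n, s 1 (s 3 u + v) = G u v].

Definition color (s : store) (u : 'I_n) := s 2 u.

Lemma env_frame s s' :
  (forall b j, b \in [:: 0; 1; 3] -> s' b j = s b j) -> env s -> env s'.
Proof.
move=> fr [e1 e2 e3]; split; rewrite ?fr //.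
by move=> u v; rewrite !fr // e3.
Qed.

Lemma env_sem p s : wf p -> 1 \notin writes p -> 3 \notin writes p -> env s -> env (sem p s).
Proof.
move=> w w1 w3; apply: env_frame => b j; rewrite !inE => /or3P[]/eqP->.
- by rewrite sem_frame // wf_writes.
- by rewrite sem_frame.
- by rewrite sem_frame.
Qed.

Lemma env_frame_for a p s s0 : wf (LFor a p) ->
  1 \notin a :: writes p -> 3 \notin a :: writes p ->
  (forall b j, b \notin a :: writes p -> s b j = s0 b j) -> env s0 -> env s.
Proof.
move=> /wf_writes w w1 w3 fr; apply: env_frame => b j.
by rewrite !inE => /or3P[]/eqP->; rewrite fr.
Qed.

Definition Bad := Set_ 8 (Const 1).

(** On truth values, [x + y - (z + 1)] is nonzero only for [x = y = 1] and [z = 0]; each of the four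
    summands is nonzero exactly where a clause of [compatible] fails. *)
Definition compat_p :=
  Set_ 8 (Const 0) ;;
  LFor 14 (LFor 15 (When
    (Add (Add (Defs.Sub (Add (Adj (Var 10) (Var 14)) (Adj (Var 12) (Var 15)))
                        (Succ (Adj (Var 14) (Var 15))))
              (Defs.Sub (Add (Adj (Var 11) (Var 14)) (Adj (Var 13) (Var 15)))
                        (Succ (Adj (Var 14) (Var 15)))))
         (Add (Pred (Add (Adj (Var 10) (Var 14)) (Adj (Var 13) (Var 14))))
              (Pred (Add (Adj (Var 12) (Var 14)) (Adj (Var 11) (Var 14))))))
    Bad)).

Definition guess (s : store) (r r' c c' : 'I_n) :=
  [/\ s 10 0 = r, s 11 0 = r', s 12 0 = c & s 13 0 = c'].

Lemma compat_pP s (r r' c c' : 'I_n) : env s -> guess s r r' c c' ->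
  (sem compat_p s 8 0 == 0) <-> compatible G r r' c c'.
Proof.
move=> es [gr gr' gc gc'].
pose Q (u v : 'I_n) := [|| [&& G r u, G c v & ~~ G u v], [&& G r' u, G c' v & ~~ G u v],
   G r u && G c' u | G c u && G r' u].
have -> : (sem compat_p s 8 0 == 0) = ~~ [exists u, exists v, Q u v].
  apply: negb_inj; rewrite negbK /compat_p sem_seq sem_write.
  rewrite (@for_exists 14 _ 8 _ n (fun i => [exists v, Q i v])) //; first by case: es.
  move=> u s1 su1 fr1.
  have es1 : env s1 by apply: (env_frame_for _ _ _ fr1) => //; apply: env_frame es => b j;
    rewrite !inE => /or3P[]/eqP->.
  rewrite (@for_exists 15 _ 8 _ n (Q u)) //; first by case: es1.
  move=> v s2 sv fr2.
  have es2 : env s2 by apply: (env_frame_for _ _ _ fr2) => //.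
  have su : s2 14 0 = u by rewrite fr2.
  have [e10 e11 e12 e13] : guess s2 r r' c c' by split; rewrite fr2 // fr1.
  have [_ _ adj] := es2.
  have and3 (x y z : bool) : (nat_of_bool x + y - (nat_of_bool z + 1) != 0) = [&& x, y & ~~ z].
    by case: x; case: y; case: z.
  have and2 (a b : bool) : (nat_of_bool a + b - 1 != 0) = a && b by case: a; case: b.
  have whenE x : (sem (When x Bad) s2 8 0 != 0) = (s2 8 0 != 0) || (eval s2 x != 0).
    by rewrite sem_if; case: ifP => e; rewrite ?orbT ?orbF.
  rewrite whenE /= e10 e11 e12 e13 su sv !adj !addn_eq0 !negb_and and3 and3 and2 and2.
  by rewrite /Q -!orbA.
split=> [/existsPn N|[b1 b2 d1 d2]].
  have {}N u v : ~~ Q u v by have /existsPn := N u.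
  split=> [u v a b|u v a b|u a|u a].
  - by apply: contraT => ab; have := N u v; rewrite /Q a b ab.
  - by apply: contraT => ab; have := N u v; rewrite /Q a b ab orbT.
  - by apply/negP => b; have := N u u; rewrite /Q a b /= !orbT.
  - by apply/negP => b; have := N u u; rewrite /Q a b /= !orbT.
apply/existsPn=> u; apply/existsPn=> v; apply/negP.
case/or4P=> [/and3P[a b]|/and3P[a b]|/andP[a]|/andP[a]].
- by rewrite b1.
- by rewrite b2.
- by rewrite (negPf (d1 _ a)).
- by rewrite (negPf (d2 _ a)).
Qed.

Definition Pick z z' i :=
  Exists 14 25 (And (Adj (Var z) (Var 14)) (Eq (Read 2 (Var 14)) i)) ;;
  Unless (Var 25)
   (Set_ 17 (Const 0) ;;
    Find 14 17 (And (Adj (Var z) (Var 14)) (Not (Read 2 (Var 14)))) ;;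
    Find 14 17 (And (And (Adj (Var z) (Var 14)) (Adj (Var z') (Var 14)))
                    (Not (Read 2 (Var 14)))) ;;
    When (Var 17) (LWrite 2 (Pred (Var 17)) i)).

Lemma eval_Adj s z z' (x x' : 'I_n) : env s -> eval s z = x -> eval s z' = x' ->
  eval s (Adj z z') = G x x'.
Proof. by case=> _ _ adj /= -> ->. Qed.

Lemma PickP s z z' (x x' : 'I_n) i : env s -> 9 < z < 14 -> 9 < z' < 14 ->
  s z 0 = x -> s z' 0 = x' -> s 15 0 = i ->
  picked G x x' i.+1 (color s) (color (sem (Pick z z' (Succ (Var 15))) s)).
Proof.
move=> es zr zr' sz sz' si; have [e0 _ _] := es.
have zn : z \notin [:: 14; 17; 25] by rewrite !inE; lia.
have zn' : z' \notin [:: 14; 17; 25] by rewrite !inE; lia.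
have good t : (forall b j, b \notin [:: 14; 17; 25] -> t b j = s b j) ->
    [/\ env t, t z 0 = x, t z' 0 = x', t 15 0 = i & forall j, t 2 j = s 2 j].
  move=> fr; split=> [||||j]; rewrite ?fr //.
  by apply: env_frame es => b j; rewrite !inE => /or3P[]/eqP->; rewrite fr.
have sub b l : all (mem [:: 14; 17; 25]) l -> b \notin [:: 14; 17; 25] -> b \notin l.
  by move=> /allP al; apply: contra => /al.
rewrite /Pick sem_seq; set p1 := Exists _ _ _; pose s1 := sem p1 s; rewrite -/s1.
have fr1 b j : b \notin [:: 14; 17; 25] -> s1 b j = s b j.
  by move=> bn; apply: sem_frame; apply: sub bn.
have h25 : (s1 25 0 != 0) = hits G (cls (color s) i.+1) x.
  rewrite (@ExistsP _ _ _ _ n (fun u => G x u && (color s u == i.+1))) //.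
    apply/existsP/exists_inP => [[u /andP[h1 h2]]|[u]]; first by exists u; rewrite ?inE.
    by rewrite inE => h1 h2; exists u; apply/andP.
  move=> u t tu fr.
  have [|et tz _ ti t2] := good t; first by move=> b j bn; rewrite fr // (sub _ _ _ bn).
  apply: eval_And; first by apply: eval_Adj.
  by rewrite eval_Eq /= tu ti t2 addn1.
rewrite /picked -h25 sem_unless [eval _ (Var 25)]/=.
case: (s1 25 0 != 0); first by move=> u; rewrite /color fr1.
rewrite !sem_seq sem_set; set p2 := Find _ _ (And (Adj _ _) _); set p3 := Find _ _ _.
set s2 := update _ _ _ _.
have fr2 b j : b \notin [:: 14; 17; 25] -> s2 b j = s b j.
  by move=> bn; rewrite -fr1 // /s2 /update (negPf (_ : b != 17)) //; apply: contra bn => /eqP->.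
have fr3 b j : b \notin [:: 14; 17; 25] -> sem p2 s2 b j = s b j.
  by move=> bn; rewrite -fr2 //; apply: sem_frame; apply: sub bn.
have fr4 b j : b \notin [:: 14; 17; 25] -> sem p3 (sem p2 s2) b j = s b j.
  by move=> bn; rewrite -fr3 //; apply: sem_frame; apply: sub bn.
have final u : color s u = 0 -> G x u ->
    (G x' u \/ forall v, G x v -> G x' v -> 0 < color s v) ->
    sem p3 (sem p2 s2) 17 0 = u.+1 ->
    exists u, [/\ color s u = 0, G x u,
      color (sem (When (Var 17) (LWrite 2 (Pred (Var 17)) (Succ (Var 15)))) (sem p3 (sem p2 s2)))
        =1 paint (color s) u i.+1 &
      G x' u \/ forall v, G x v -> G x' v -> 0 < color s v].
  move=> cu xu pref e; exists u; split=> // v.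
  rewrite sem_when sem_write /= e /= fr4 // si addn1 subn1 /= /color /update /=.
  by rewrite /paint fr4 // -val_eqE.
have [|u t tu fr|[u0 /andP[xu0 /eqP cu0] e]|[none _]] :=
  @FindP 14 17 (And (Adj (Var z) (Var 14)) (Not (Read 2 (Var 14)))) s2 n
    (fun u => G x u && (color s u == 0)) isT isT isT.
- by rewrite fr2.
- have [|et tz _ ti t2] := good t.
    by move=> b j bn; rewrite fr ?fr2 // (sub _ _ _ bn).
  apply: eval_And; first by apply: eval_Adj.
  by rewrite eval_Not /= tu t2.
- left; have [|u t tu fr|[u1 /andP[/andP[xu1 xu1'] /eqP cu1] e1]|[none e1]] :=
    @FindP 14 17 (And (And (Adj (Var z) (Var 14)) (Adj (Var z') (Var 14)))
      (Not (Read 2 (Var 14)))) (sem p2 s2) n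
      (fun u => (G x u && G x' u) && (color s u == 0)) isT isT isT.
  + by rewrite fr3.
  + have [|et tz tz' ti t2] := good t.
      by move=> b j bn; rewrite fr ?fr3 // (sub _ _ _ bn).
    apply: eval_And; last by rewrite eval_Not /= tu t2.
    by apply: eval_And; apply: eval_Adj.
  + by apply: (final u1) => //; left.
  + apply: (final u0) => //; last by rewrite e1.
    by right=> v xv xv'; rewrite lt0n; have := none v; rewrite xv xv'.
- by right=> u xu; rewrite lt0n; have := none u; rewrite xu.
Qed.

(** Loops run to [n], so a test singles out the first [k] rounds; round [i] treats colour [i.+1]. *)
Definition Attach z z' :=
  LFor 15 (When (Defs.Sub K_ (Var 15))
    (Pick z z' (Succ (Var 15)) ;; Pick z' z (Succ (Var 15)))).

Lemma AttachP s z z' (r r' c c' : 'I_n) : env s -> 9 < z < 14 -> 9 < z' < 14 ->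
  s z 0 = r -> s z' 0 = r' -> k <= n ->
  compatible G r r' c c' -> (forall v, k <= #|nbhd G v|) ->
  partial_coloring G k r r' c c' (color s) -> balanced G k r r' 0 (color s) ->
  let s' := sem (Attach z z') s in
  [/\ partial_coloring G k r r' c c' (color s'),
      forall u, 0 < color s u -> color s' u = color s u,
      forall i, 0 < i <= k -> hits G (cls (color s') i) r && hits G (cls (color s') i) r' &
      forall j x, 0 < j -> x \in [:: c; c'] ->
        hits G (cls (color s') j) x = hits G (cls (color s) j) x].
Proof.
move=> es zr zr' sz sz' kn cpt deg pc bal; have [e0 _ _] := es.
pose I i t := [/\ partial_coloring G k r r' c c' (color t),
  forall u, 0 < color s u -> color t u = color s u,
  forall j, 0 < j <= k -> j <= i -> hits G (cls (color t) j) r && hits G (cls (color t) j) r',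
  forall j x, 0 < j -> x \in [:: c; c'] ->
        hits G (cls (color t) j) x = hits G (cls (color s) j) x &
  balanced G k r r' i (color t)].
suff [h1 h2 h3 h4 _] : I n (sem (Attach z z') s).
  by split=> // i ik; apply: h3; rewrite // (leq_trans _ kn) //; case/andP: ik.
apply: sem_for => //; first by split=> // j /andP[j0 _]; rewrite leqNgt j0.
move=> i t lt ti fr [h1 h2 h3 h4 h5].
rewrite /I.
have et : env t by apply: (env_frame_for _ _ _ fr).
have zl (l : seq nat) : all (fun a => (a < 10) || (13 < a)) l -> z \notin l.
  by move=> /allP al; apply/negP => /al; lia.
have zl' (l : seq nat) : all (fun a => (a < 10) || (13 < a)) l -> z' \notin l.
  by move=> /allP al; apply/negP => /al; lia.
have tz : t z 0 = r by rewrite fr // zl.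
have tz' : t z' 0 = r' by rewrite fr // zl'.
pose t1 := sem (Pick z z' (Succ (Var 15))) t.
pose t2 := sem (Pick z' z (Succ (Var 15))) t1.
have -> : color (update (sem (When (Defs.Sub K_ (Var 15))
    (Pick z z' (Succ (Var 15)) ;; Pick z' z (Succ (Var 15)))) t) 15 0 i.+1) =
    color (if i < k then t2 else t).
  rewrite sem_when [eval _ _]/= ti; have [_ -> _] := et.
  by rewrite -subn_gt0 lt0n; case: (k - i).
have [ik|ki] := ltnP i k; last first.
  split=> //; first by move=> j jk _; apply: h3 => //; apply: leq_trans ki; case/andP: jk.
  by right=> j /andP[ij jk]; exfalso; clear -ij jk ki; lia.
have p1 : picked G r r' i.+1 (color t) (color t1) by apply: PickP.
have et1 : env t1 by apply: env_sem.
have p2 : picked G r' r i.+1 (color t1) (color t2).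
  by apply: PickP => //; rewrite /t1 sem_frame // ?zl ?zl'.
have [||g1 g2 g3 g4 g5] := attach_step cpt deg h1 _ _ p1 p2 => //.
split=> //.
- by move=> u u0; rewrite g2 h2.
- move=> j jk; rewrite leq_eqVlt => /orP[/eqP->//|]; rewrite ltnS => ji.
  have [j0 _] := andP jk.
  by rewrite !g4 ?ltn_eqF //; apply: h3.
- by move=> j x j0 xc; rewrite g5 ?h4.
- case: h5 => b; [left=> u ru r'u|right=> j /andP[ij jk]].
    by rewrite g2 b.
  have j0 : 0 < j by apply: leq_ltn_trans ij.
  by rewrite !g4 ?gtn_eqF // b // jk ltnW.
Qed.

(** Only domination has to be tested: for a compatible guess the classes are nonempty and connected
    by construction, whether or not the guess is controlling. *)
Definition Check :=
  Set_ 8 (Const 0) ;;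
  LFor 14 (LFor 15 (When (Defs.Sub K_ (Var 15))
    (Unless (Eq (Read 2 (Var 14)) (Succ (Var 15)))
      (Exists 22 25 (And (Adj (Var 14) (Var 22)) (Eq (Read 2 (Var 22)) (Succ (Var 15)))) ;;
       Unless (Var 25) Bad)))).

Lemma CheckP s : env s ->
  (sem Check s 8 0 == 0) = [forall v, forall i : 'I_n, (i < k) ==>
    (color s v == i.+1) || [exists w, G v w && (color s w == i.+1)]].
Proof.
move=> es; apply: negb_inj; rewrite negb_forall.
rewrite sem_seq sem_set (@for_exists 14 _ 8 _ n (fun v => ~~ [forall i : 'I_n, (i < k) ==>
    (color s v == i.+1) || [exists w, G v w && (color s w == i.+1)]])) //; first by case: es.
move=> v t tv fr.
have et : env t by apply: (env_frame_for _ _ _ fr) => //; apply: env_frame es => b j;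
    rewrite !inE => /or3P[]/eqP->.
rewrite negb_forall (@for_exists 15 _ 8 _ n (fun i => ~~ ((i < k) ==>
    (color s v == i.+1) || [exists w, G v w && (color s w == i.+1)]))) //; first by case: et.
move=> i t' ti fr'.
have et' : env t' by apply: (env_frame_for _ _ _ fr').
have tv' : t' 14 0 = v by rewrite fr'.
have t2 j : t' 2 j = s 2 j by rewrite fr' // fr.
rewrite sem_when [eval _ _]/= ti; have [e0 -> _] := et'.
rewrite subn_eq0 -ltnNge; case: (i < k) => /=; last by rewrite orbF.
rewrite sem_unless eval_Eq /= tv' ti t2 addn1 eqb0 negbK /color; case: (s 2 v == i.+1) => /=.
  by rewrite orbF.
rewrite sem_seq; set u := sem (Exists _ _ _) t'.
have u8 : u 8 0 = t' 8 0 by apply: sem_frame.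
rewrite sem_unless [eval _ _]/= /u.
rewrite (@ExistsP _ _ _ _ n (fun w => G v w && (color s w == i.+1))) //; last first.
  move=> w t3 tw fr3; have et3 : env t3.
    by apply: env_frame et' => b j; rewrite !inE => /or3P[]/eqP->; rewrite fr3.
  apply: eval_And; first by apply: eval_Adj; rewrite //= fr3.
  by rewrite eval_Eq /= tw !fr3 // ti t2 addn1.
case: ifP => _; rewrite -/u ?u8 ?orbF //.
by rewrite /Bad sem_set /update /= orbT.
Qed.

(** Free vertices may join any class, because a connected dominating set stays connected and
    dominating when vertices are added. *)
Definition Finish :=
  LFor 14 (Unless (Read 2 (Var 14)) (LWrite 2 (Var 14) (Const 1))) ;; Set_ 9 (Const 1).

Lemma FinishP s u : s 0 0 = n ->
  color (sem Finish s) u = if color s u == 0 then 1 else color s u.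
Proof.
move=> s0; rewrite /Finish sem_seq sem_set.
pose I i t := forall v : 'I_n,
  color t v = if (v < i) && (color s v == 0) then 1 else color s v.
have : I n (sem (LFor 14 (Unless (Read 2 (Var 14)) (LWrite 2 (Var 14) (Const 1)))) s).
  apply: sem_for => // i t lt ti fr h v.
  transitivity (color (sem (Unless (Read 2 (Var 14)) (LWrite 2 (Var 14) (Const 1))) t) v) => //.
  rewrite sem_unless /= ti -[t 2 i]/(color t (Ordinal lt)) h ltnn /=.
  have [ev|nv] := eqVneq v (Ordinal lt).
    rewrite ev /= ltnSn /=; case: eqP => /= e; first by rewrite sem_write /= ti /color /update /= eqxx.
    by rewrite h /= ltnn.
  have -> : (v < i.+1) = (v < i) by rewrite ltnS leq_eqVlt -[i]/(val (Ordinal lt)) val_eqE (negPf nv).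
  rewrite -h; case: eqP => //= _; rewrite sem_write /= ti /color /update /=.
  by rewrite -[i]/(val (Ordinal lt)) val_eqE (negPf nv).
by move/(_ u); rewrite ltn_ord.
Qed.

End Pieces.

Definition Or x y := Not (Not (Add x y)).

Lemma eval_Or s x y (a b : bool) :
  (eval s x != 0) = a -> (eval s y != 0) = b -> eval s (Or x y) = a || b.
Proof. by move=> <- <-; rewrite !eval_Not /= eqb0 addn_eq0 negb_and. Qed.

Lemma nz_bool (b : bool) : (nat_of_bool b != 0) = b.
Proof. by case: b. Qed.

(** * The auction *)

Section Auction.

Variables (n k : nat) (G : sgraph 'I_n) (X Y : {set 'I_n}).

Definition reach (v w : 'I_n) := (v == w) || G v w.

(** Prices above [n], the number of vertices, are out of reach: a bidder all of whose options cost
    that much may give up, which is the case of unmatched vertices allowed in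
    [priced_matching_large]. *)
Definition Candidate :=
  And (And (Not (Read 6 (Var 22))) (Not (Defs.Sub (Read 5 (Var 22)) N_)))
   (And (Or (Eq (Var 16) (Succ (Var 22))) (Adj (Pred (Var 16)) (Var 22)))
        (Or (Not (Var 17))
            (Defs.Sub (Read 5 (Pred (Var 17))) (Read 5 (Var 22))))).

Definition Cheapest :=
  Set_ 17 (Const 0) ;; LFor 22 (When Candidate (Set_ 17 (Succ (Var 22)))).

Definition Bid :=
  Cheapest ;;
  LIf (Var 17)
    (Set_ 18 (Read 4 (Pred (Var 17))) ;;
     LWrite 4 (Pred (Var 17)) (Var 16) ;;
     LWrite 5 (Pred (Var 17)) (Succ (Read 5 (Pred (Var 17)))) ;;
     Set_ 16 (Var 18))
    (Set_ 16 (Const 0)).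

Definition Match :=
  LFor 14 (
    LIf (Read 7 (Var 14)) (Set_ 16 (Const 0)) (Set_ 16 (Succ (Var 14))) ;;
    LFor 19 (LFor 20 (LFor 21 (When (Var 16) Bid)))).

Definition owner (s : store) (w : 'I_n) : option 'I_n :=
  if s 4 w is v.+1 then insub v else None.
Definition price (s : store) (w : 'I_n) := s 5 w.

Lemma ownerP s (w v : 'I_n) : owner s w = Some v <-> s 4 w = v.+1.
Proof.
rewrite /owner; case: (s 4 w) => [|m]; split=> //.
  by case: insubP => // u _ <- [<-].
by case=> ->; rewrite valK.
Qed.

Definition terminals s :=
  (forall u : 'I_n, (s 6 u != 0) = (u \in X)) /\ (forall u : 'I_n, (s 7 u != 0) = (u \in Y)).

Definition candidate s (v w : 'I_n) := [&& w \notin X, price s w <= n & reach v w].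

Lemma CheapestP s (v : 'I_n) : env k G s -> terminals s -> s 16 0 = v.+1 ->
  let t := sem Cheapest s in
  (t 17 0 = 0 /\ forall w, ~~ candidate s v w) \/
  exists b : 'I_n, [/\ t 17 0 = b.+1, candidate s v b &
    forall w, candidate s v w -> price s b <= price s w].
Proof.
move=> es [tX tY] cur /=; rewrite /Cheapest sem_seq sem_set; set s1 := update _ _ _ _.
have es1 : env k G s1 by apply: env_frame es => b j; rewrite !inE => /or3P[]/eqP->.
pose I i t := (t 17 0 = 0 /\ forall w : 'I_n, w < i -> ~~ candidate s v w) \/
  exists b : 'I_n, [/\ t 17 0 = b.+1, candidate s v b &
    forall w : 'I_n, w < i -> candidate s v w -> price s b <= price s w].
have : I n (sem (LFor 22 (When Candidate (Set_ 17 (Succ (Var 22))))) s1).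
  apply: sem_for => //; [by case: es1 | by left|].
  move=> i t lt ti fr IH.
  have et : env k G t by apply: (env_frame_for _ _ _ fr).
  pose w : 'I_n := Ordinal lt.
  have t5 j : t 5 j = s 5 j by rewrite fr.
  have t6 j : t 6 j = s 6 j by rewrite fr.
  have t16 : t 16 0 = v.+1 by rewrite fr.
  have [t0 _ _] := et.
  have ev : eval t Candidate = candidate s v w &&
      ((t 17 0 == 0) || (price s w < s 5 (t 17 0 - 1))).
    rewrite /candidate -andbA (andbA (w \notin X)) -andbA.
    rewrite (@eval_And _ _ _ ((w \notin X) && (price s w <= n))
      (reach v w && ((t 17 0 == 0) || (price s w < s 5 (t 17 0 - 1))))) ?andbA //.
      apply: eval_And; rewrite eval_Not /= ti.
        by rewrite t6 -[i]/(val w) -tX negbK.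
      by rewrite t5 t0 subn_eq0.
    apply: eval_And; apply: eval_Or.
    - by rewrite eval_Eq nz_bool /= t16 ti addn1 eqSS -[i]/(val w) val_eqE.
    - by rewrite (eval_Adj (x := v) (x' := w) et) ?nz_bool //= t16 subn1.
    - by rewrite eval_Not nz_bool.
    - by rewrite /= ti !t5 subn_eq0 -ltnNge.
  have upd : update (sem (When Candidate (Set_ 17 (Succ (Var 22)))) t) 22 0 i.+1 17 0
      = if candidate s v w && ((t 17 0 == 0) || (price s w < s 5 (t 17 0 - 1)))
        then w.+1 else t 17 0.
    transitivity (sem (When Candidate (Set_ 17 (Succ (Var 22)))) t 17 0) => //.
    rewrite sem_when ev nz_bool; case: ifP => // _.
    by rewrite sem_set /update /= ti addn1.
  have split_lt (u : 'I_n) : u < i.+1 -> u = w \/ u < i.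
    rewrite ltnS leq_eqVlt => /orP[/eqP e|]; [left; exact: val_inj | by right].
  rewrite /I upd; case: ifPn => [/andP[cw /orP[t17|lt17]]|nc].
  - right; exists w; split=> // u /split_lt[-> //|ui] cu.
    by case: IH => [[_ /(_ u ui)]|[b [e]]]; [rewrite cu | rewrite e in t17].
  - right; exists w; split=> // u /split_lt[-> //|ui] cu.
    case: IH => [[_ /(_ u ui)]|[b [e cb bmin]]]; first by rewrite cu.
    apply: leq_trans (ltnW lt17) _; rewrite e subn1; exact: bmin.
  - case: IH => [[e none]|[b [e cb bmin]]].
      left; split=> // u /split_lt[->|/none //].
      by move: nc; rewrite e eqxx andbT.
    right; exists b; split=> // u /split_lt[-> cw|/bmin]; last by apply.
    by move: nc; rewrite cw e /= subn1 -leqNgt.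
case=> [[e none]|[b [e cb bmin]]]; first by left; split=> // w; apply: none.
by right; exists b; split=> // w; apply: bmin.
Qed.

(* Vertices below [i] have been inserted; [s 16 0] holds, shifted by one, the  *)
(* vertex looking for a partner, if any.                                       *)
Definition auction_inv i s :=
  [/\ [/\ env k G s, terminals s & forall w : 'I_n, s 4 w <= n],
      priced_matching (~: Y) (~: X) reach (owner s) (price s) /\
        (forall w, price s w <= n.+1),
      s 16 0 = 0 \/ exists v : 'I_n, [/\ s 16 0 = v.+1, v \notin Y, v < i &
                                       forall w, owner s w <> Some v],
      forall v : 'I_n, v \notin Y -> v < i -> (forall w, owner s w <> Some v) ->
        s 16 0 = v.+1 \/ forall w, w \notin X -> reach v w -> n < price s w
    & forall w v, owner s w = Some v -> v < i].

Lemma eq_auction_inv i s t :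
  (forall b j, b \in [:: 0; 1; 3; 4; 5; 6; 7; 16] -> t b j = s b j) ->
  auction_inv i s -> auction_inv i t.
Proof.
move=> fr [[h1 [hX hY] h2] [[p1 p2 p3 p4] h4] h5 h6 h7].
have eo w : owner t w = owner s w by rewrite /owner fr.
have ep w : price t w = price s w by rewrite /price fr.
split.
- split; last by move=> w; rewrite fr.
    by apply: env_frame h1 => b j; rewrite !inE => /or3P[]/eqP->; rewrite fr.
  by split=> u; rewrite fr.
- split; last by move=> w; rewrite ep.
  split=> [w v|w w' v|w|w v w']; rewrite ?eo ?ep //; [exact: p1|exact: p2|exact: p3|exact: p4].
- rewrite fr //; case: h5 => [|[v [h51 h52 h53 h54]]]; [by left | right; exists v; split=> // w].
  by rewrite eo.
- move=> v vY vi nv; rewrite fr //.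
  case: (h6 v vY vi) => [w|->|st]; [by rewrite -eo | by left | right=> w wX vw].
  by rewrite ep st.
- by move=> w v; rewrite eo; apply: h7.
Qed.

(** A bidder that gives up need not return, because prices never fall. An evicted owner becomes the
    next bidder, so at most one vertex is waiting at any time. *)
Lemma BidP i s : auction_inv i s -> s 16 0 != 0 ->
  let t := sem Bid s in
  auction_inv i t /\ (t 16 0 = 0 \/ \sum_w price t w = (\sum_w price s w).+1).
Proof.
move=> [[es ts s4] [pm hn] cur sett below] cur0 /=.
case: cur => [e|[v [cur vY vi nv]]]; first by rewrite e in cur0.
rewrite /Bid sem_seq; pose s1 := sem Cheapest s; rewrite -/s1.
have fr1 b j : b \notin [:: 17; 22] -> s1 b j = s b j.
  by move=> bn; apply: sem_frame; move: bn; rewrite !inE; do 2!case: (b == _).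
have [[e none]|[b [e /and3P[bX bn vb] bmin]]] := CheapestP es ts cur; rewrite -/s1 in e.
  rewrite sem_if [eval _ _]/= e /= sem_set; split; last by left.
  have [tX tY] := ts; set t := update _ _ _ _.
  have frt b j : b \notin [:: 16; 17; 22] -> t b j = s b j.
    move=> bn; rewrite -(fr1 b); last by move: bn; rewrite !inE; case: (b == 16).
    by rewrite /t /update; move: bn; rewrite !inE; case: (b == 16).
  have eo w : owner t w = owner s w by rewrite /owner frt.
  have ep w : price t w = price s w by rewrite /price frt.
  split.
  - split; last by move=> w; rewrite frt.
      by apply: env_frame es => b j; rewrite !inE => /or3P[]/eqP->; rewrite frt.
    by split=> u; rewrite frt.
  - split; last by move=> w; rewrite ep.
    case: pm => p1 p2 p3 p4.
    split=> [w v'|w w' v'|w|w v' w']; rewrite ?eo ?ep //; [exact: p1|exact: p2|exact: p3|exact: p4].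
  - by left.
  - move=> v' v'Y v'i nv'; right=> w wX v'w; rewrite /price frt //.
    have nv2 w' : owner s w' <> Some v' by rewrite -eo.
    case: (sett v' v'Y v'i nv2) => [|st]; last exact: st.
    rewrite cur => -[ev]; have {ev} ev : v = v' by apply: val_inj.
    rewrite -ev in v'w; have := none w; rewrite /candidate wX v'w andbT /=.
    by rewrite -ltnNge.
  - by move=> w v'; rewrite /owner frt //; apply: below.
rewrite sem_if [eval _ _]/= e /= !semE.
set t := update _ 16 0 _.
have t4 (w : 'I_n) : t 4 w = if w == b then v.+1 else s 4 w.
  by rewrite /t /update /= e subn1 -val_eqE /= !fr1 // cur; case: eqP.
have t5 (w : 'I_n) : t 5 w = if w == b then (s 5 b).+1 else s 5 w.
  by rewrite /t /update /= e subn1 -val_eqE /= !fr1 // addn1; case: eqP.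
have t16 : t 16 0 = s 4 b by rewrite /t /update /= e subn1 fr1.
have frt a j : a \notin [:: 4; 5; 16; 17; 18; 22] -> t a j = s a j.
  move=> an; rewrite -(fr1 a); last first.
    by apply: contra an; rewrite !inE => /orP[]->; rewrite ?orbT.
  by rewrite /t /update; move: an; rewrite !inE !negb_or => /and5P[/negPf-> /negPf-> /negPf-> _ /andP[/negPf-> _]].
have eo w : owner t w = if w == b then Some v else owner s w.
  by rewrite /owner t4; case: eqP => // _; rewrite valK.
have ep w : price t w = if w == b then (price s b).+1 else price s w.
  by rewrite /price t5.
have mono w : price s w <= price t w by rewrite ep; case: eqP => [->|].
have [tX tY] := ts; have [p1 p2 p3 p4] := pm.
split; last first.
  right; rewrite (bigD1 b) //= [in RHS](bigD1 b) //= ep eqxx addSn; congr (_ + _).+1.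
  by apply: eq_bigr => w /negPf wb; rewrite ep wb.
split.
- split.
  + by apply: env_frame es => a j; rewrite !inE => /or3P[]/eqP->; rewrite frt.
  + by split=> u; rewrite frt.
  + by move=> w; rewrite t4; case: eqP.
- split; last by move=> w; rewrite ep; case: eqP.
  apply: bump_priced_matching eo ep => //; rewrite ?inE // => w.
  rewrite inE => wX vw; have [wn|nw] := leqP (price s w) n.
    by apply: bmin; rewrite /candidate wX wn.
  exact: leq_trans bn (ltnW nw).
- rewrite t16; case e4: (s 4 b) => [|m]; [by left | right].
  have mn : m < n by rewrite -e4.
  have ob : owner s b = Some (Ordinal mn) by apply/ownerP; rewrite e4.
  exists (Ordinal mn); split=> //; first by have [_] := p1 _ _ ob; rewrite inE.
    exact: below ob.
  move=> w; rewrite eo; case: eqP => [_ [ev]|wb ow]; first by case: (nv b); rewrite ev.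
  by apply: wb; apply: p2 ow ob.
- move=> v' v'Y v'i nv'; rewrite t16.
  have [/existsP[w /eqP ow]|/existsPn nw] := boolP [exists w, owner s w == Some v'].
    have := nv' w; rewrite eo; case: eqP => [ewb _|_ /(_ ow) //].
    by left; apply/ownerP; rewrite -ewb.
  case: (sett v' v'Y v'i) => [w|ev|st].
  + by apply/eqP.
  + case: (nv' b); rewrite eo eqxx; congr Some; apply: val_inj; by move: ev; rewrite cur => -[].
  + by right=> w wX v'w; apply: leq_trans (st _ wX v'w) (mono w).
- by move=> w v'; rewrite eo; case: eqP => [_ [<-]|_]; [ | apply: below].
Qed.

(** [P N] stands for a progress of at least [N]; the rule multiplies the progress of one round
    through nested loops. *)
Lemma sem_for_count (P : nat -> store -> Prop) a p m N s :
  wf (LFor a p) -> s 0 0 = n ->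
  (forall N t i, P N t -> P N (update t a 0 i)) ->
  (forall N t, t 0 0 = n -> P N t -> P (N + m) (sem p t)) ->
  P N s -> P (N + n * m) (sem (LFor a p) s).
Proof.
move=> w s0 Pu Pp Ps.
apply: (sem_for (I := fun i => P (N + i * m))) => //; first by rewrite addn0; apply: Pu.
move=> i t _ _ fr Pt; apply: Pu; rewrite mulSn [m + _]addnC addnA; apply: Pp => //.
by rewrite fr // (wf_writes w).
Qed.

Lemma auction_inv_update i s a j x :
  a \notin [:: 0; 1; 3; 4; 5; 6; 7; 16] -> auction_inv i s -> auction_inv i (update s a j x).
Proof.
move=> an; apply: eq_auction_inv => b j' bin; rewrite /update.
by case: eqP => // e; rewrite -e bin in an.
Qed.

(** Every bid raises the sum of the prices by one unless the bidder gives up, and this sum is at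
    most [n * n.+1], which is less than [n ^ 3] because [1 < n]; so three nested loops leave nobody
    waiting. Clearing cell 16 in the invariant makes it independent of what the cell holds before
    the first round. *)
Lemma MatchP s : 1 < n -> env k G s -> terminals s ->
  (forall u : 'I_n, s 4 u = 0) -> (forall u : 'I_n, s 5 u = 0) ->
  let t := sem Match s in auction_inv n (update t 16 0 0).
Proof.
move=> n1 es ts z4 z5 /=.
have o0 w : owner s w = None by rewrite /owner z4.
apply: (sem_for (I := fun i t => auction_inv i (update t 16 0 0))) => //.
- by case: es.
- split.
  + split=> // w.
    by rewrite /update /= z4.
  + split; last by move=> w; rewrite /price /update /= z5.
    have oU w : owner (update (update s 14 0 0) 16 0 0) w = None by apply: o0.
    by split=> [w v|w w' v|w|w v w']; rewrite ?oU // /price /update /= z5.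
  + by left.
  + by [].
  + by move=> w v; rewrite [owner _ _]o0.
move=> i t lt ti fr inv; pose v : 'I_n := Ordinal lt.
set t1 := sem (LIf (Read 7 (Var 14)) (Set_ 16 (Const 0)) (Set_ 16 (Succ (Var 14)))) t.
have inv1 : auction_inv i.+1 t1.
  case: inv => [[h1 [hX hY] h2] [pm h4] h5 h6 h7].
  have -> : t1 = update t 16 0 (if s 7 i != 0 then 0 else i + 1).
    by rewrite /t1 sem_if /= ti fr //; case: ifP => _; rewrite sem_set /= ?ti.
  have s7 : (s 7 i != 0) = (v \in Y) by case: ts => _ <-.
  have lt_i (u : 'I_n) : u < i.+1 -> u = v \/ u < i.
    by rewrite ltnS leq_eqVlt => /orP[/eqP e|]; [left; exact: val_inj | right].
  split=> //.
  + rewrite s7 {1}/update /=; case: ifPn => vY; [by left | right].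
    exists v; rewrite addn1; split=> // w ow.
    by have := h7 w v ow; rewrite ltnn.
  + move=> u uY ui nu; rewrite {1}/update /= s7; case: ifPn => vY.
      have [uv|{}ui] := lt_i _ ui; first by rewrite uv vY in uY.
      by case: (h6 u uY ui nu) => // st; right.
    have [->|{}ui] := lt_i _ ui; first by left; rewrite addn1.
    by case: (h6 u uY ui nu) => // st; right.
  + by move=> w u ow; apply: ltnW; apply: (h7 w u ow).
pose P N t := auction_inv i.+1 t /\ (t 16 0 = 0 \/ N <= \sum_w price t w).
have Pu N a j : a \notin [:: 0; 1; 3; 4; 5; 6; 7; 16] -> forall t, P N t -> P N (update t a 0 j).
  move=> an u [h1 h2]; split; first exact: auction_inv_update.
  have ne b : b \in [:: 0; 1; 3; 4; 5; 6; 7; 16] -> (b == a) = false.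
    by move=> bin; apply/eqP => e; rewrite -e bin in an.
  by rewrite {1}/update ne //=; case: h2; [left | right; under eq_bigr do rewrite /price /update ne //=].
pose L1 := LFor 21 (When (Var 16) Bid); pose L2 := LFor 20 L1; pose L3 := LFor 19 L2.
have n0 u : auction_inv i.+1 u -> u 0 0 = n by case=> [[[]]].
have PL : P (0 + n * (n * (n * 1))) (sem L3 t1).
  apply: (sem_for_count (P := P)) => //; first exact: n0.
  - move=> N1 u1 u10 Pu1; apply: (sem_for_count (P := P)) => //.

    move=> N2 u2 u20 Pu2; apply: (sem_for_count (P := P)) => //.

    move=> N3 u3 u30 [Pu3 h3]; rewrite /P sem_when [eval _ _]/=; case: (eqVneq (u3 16 0) 0) => /= cur.
      by split=> //; left.
    have [g1 g2] := BidP Pu3 cur; split=> //.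
    case: g2 => [|->]; [by left | right]; rewrite addn1 ltnS.
    by case: h3 => [h|//]; rewrite h in cur.
  by split=> //; right.
case: PL => invL cnt.
have curL : sem L3 t1 16 0 = 0.
  case: cnt => // big; exfalso; case: invL => _ [_ hn] _ _ _.
  have : \sum_w price (sem L3 t1) w <= \sum_(w < n) n.+1 by apply: leq_sum => w _.
  rewrite sum_nat_const card_ord => le; have := leq_trans big le; clear -n1; nia.
apply: eq_auction_inv invL => b j bin.
rewrite sem_seq -/t1 /update; case: (eqVneq b 16) => [->|_] /=.
  by case: (eqVneq j 0) => [->|_]; rewrite ?curL.
by case: (eqVneq b 14) => [e|_] //; rewrite e in bin.
Qed.

End Auction.

(** * Colouring the walks *)

Section WalkColoring.

Variables (T : finType) (G : sgraph T) (k : nat) (r r' c c' : T).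
Variables (go : T -> option T).

Let X := nbhd G r :|: nbhd G c.
Let Y := nbhd G r' :|: nbhd G c'.

Hypothesis cpt : compatible G r r' c c'.
Hypothesis goP : forall w v, go w = Some v ->
  [/\ w \notin X, v \notin Y & (v == w) || G v w].
Hypothesis go_inj : forall w w' v, go w = Some v -> go w' = Some v -> w = w'.

Definition walks_colored (col : T -> nat) (es : seq T) :=
  [/\ uniq es, {subset es <= good X Y go}, forall u, col u <= size es
    & forall x0 i, i < size es -> cls col i.+1 = walk go (nth x0 es i)].

Lemma walks_colored_mem col es y : walks_colored col es -> y \in es ->
  cls col (index y es).+1 = walk go y.
Proof. by move=> [_ _ _ h] yes; rewrite (h y) ?index_mem // nth_index. Qed.

(** A walk has only its start in [Y] and only its end in [X], hence at most one vertex in each of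
    the four neighbourhoods. *)
Lemma walks_colored_partial col es : walks_colored col es -> size es = k ->
  partial_coloring G k r r' c c' col.
Proof.
move=> [ues sub le h] <-.
have clsP i : 0 < i <= size es -> exists2 y, y \in good X Y go & cls col i = walk go y.
  by case: i => // i /= lt; exists (nth r es i); [apply/sub/mem_nth | apply: h].
have hitsP z z' y u : u \in nbhd G z :|: nbhd G z' -> u \in walk go y ->
    hits G (walk go y) z || hits G (walk go y) z'.
  rewrite !inE => /orP[] zu uw; apply/orP; [left|right];
  by apply/exists_inP; exists u.
split=> //.
- by move=> i /clsP[y]; rewrite inE => /andP[yY _] ->; apply: (walk_connected goP).
- move=> i /clsP[y]; rewrite inE => /andP[yY yX] ->.
  by have [_ lw _ _] := walkP goP go_inj yY; apply: hitsP yX lw.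
- move=> i /clsP[y]; rewrite inE => /andP[yY yX] ->.
  by have [yw _ _ _] := walkP goP go_inj yY; apply: hitsP yY yw.
- move=> z u v zin zu zv e u0.
  have [|y] := clsP (col u); first by rewrite u0 le.
  rewrite inE => /andP[yY yX] ew.
  have uw : u \in walk go y by rewrite -ew inE.
  have vw : v \in walk go y by rewrite -ew inE e.
  have inX x : z \in [:: r; c] -> G z x -> x \in X.
    by rewrite !inE => /orP[]/eqP-> ->; rewrite ?orbT.
  have inY x : z \in [:: r'; c'] -> G z x -> x \in Y.
    by rewrite !inE => /orP[]/eqP-> ->; rewrite ?orbT.
  have [zX|zY] : z \in [:: r; c] \/ z \in [:: r'; c'].
    by move: zin; rewrite !inE => /or4P[]->; rewrite ?orbT; auto.
    by rewrite (walk_in_X goP yY uw (inX _ zX zu)) (walk_in_X goP yY vw (inX _ zX zv)).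
  by rewrite (walk_in_Y goP yY uw (inY _ zY zu)) (walk_in_Y goP yY vw (inY _ zY zv)).
Qed.

(** In the first case every common neighbour of [r] and [r'], or of [c] and [c'], lies in both [X]
    and [Y] and is therefore coloured. In the second case every class is a single vertex of [X] and
    [Y], and by compatibility it is adjacent to [r] and [r'] only, or to [c] and [c'] only, among
    the four. *)
Lemma walks_colored_balanced col es : walks_colored col es -> size es = k ->
  (forall y, y \in X -> y \in Y -> y \in es) \/ (forall y, y \in es -> y \in X) ->
  balanced G k r r' 0 col /\ balanced G k c c' 0 col.
Proof.
move=> wc sk triv; have [ues sub le h] := wc; have [b1 b2 d1 d2] := cpt.
case: triv => triv.
  have colored u : u \in X -> u \in Y -> 0 < col u.
    move=> uX uY; have ues' := triv u uX uY.
    have : u \in walk go u.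
      by have [] := walkP goP go_inj uY.
    by rewrite -(walks_colored_mem wc ues') inE => /eqP->.
  by split; left=> u ru r'u; apply: colored; rewrite !inE ?ru ?r'u ?orbT.
have single i : 0 < i <= k -> exists y, [/\ cls col i = [set y], y \in X & y \in Y].
  rewrite -sk; case: i => // i /= lt; have yes : nth r es i \in es by apply: mem_nth.
  exists (nth r es i); rewrite (h r) // (walk_trivial goP) ?triv //.
  by split=> //; have := sub _ yes; rewrite inE => /andP[].
have hits1 y z : hits G [set y] z = G z y.
  apply/exists_inP/idP => [[u]|zy]; first by rewrite inE => /eqP->.
  by exists y; rewrite ?inE.
split; right=> i /single[y [-> ]]; rewrite !hits1 !inE.
- case/orP=> zy /orP[] z'y; rewrite ?zy ?z'y //.
  + by have := d1 _ zy; rewrite z'y.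
  + by have := d2 _ zy; rewrite z'y.
  + transitivity false; first by apply/negP => /d1; rewrite z'y.
    by symmetry; apply/negP => r'y; have := d2 _ zy; rewrite r'y.
- case/orP=> zy /orP[] z'y; rewrite ?zy ?z'y //.
  + transitivity false; first by apply/negP => /d2; rewrite z'y.
    by symmetry; apply/negP => r'y; have := d1 _ zy; rewrite r'y.
  + by have := d1 _ zy; rewrite z'y.
  + by have := d2 _ zy; rewrite z'y.
Qed.

Lemma walks_colored_rcons col col' es y : walks_colored col es ->
  y \in good X Y go -> y \notin es ->
  (forall u, col' u = if u \in walk go y then (size es).+1 else col u) ->
  walks_colored col' (rcons es y).
Proof.
move=> [ues sub le h] yg yes e; have := yg; rewrite inE => /andP[yY _].
split.
- by rewrite rcons_uniq yes.
- by move=> x; rewrite mem_rcons inE => /orP[/eqP->|/sub].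
- by move=> u; rewrite size_rcons e; case: ifP => // _; apply: leqW.
move=> x0 i; rewrite size_rcons ltnS leq_eqVlt nth_rcons => /orP[/eqP->|lt].
  rewrite ltnn eqxx; apply/setP=> u; rewrite inE e; case: ifP => [_|_]; first by rewrite eqxx.
  by apply/negP => /eqP eu; have := le u; rewrite eu ltnn.
rewrite lt -(h x0 i lt); apply/setP=> u; rewrite !inE e; case: ifP => // uw.
rewrite eqSS gtn_eqF //; symmetry; apply/negP => /eqP ci.
have uw' : u \in walk go (nth x0 es i) by rewrite -(h x0 i lt) inE ci.
have xes : nth x0 es i \in es by apply: mem_nth.
have := sub _ xes; rewrite inE => /andP[xY _].
by case/negP: yes; rewrite (walk_inj goP go_inj yY xY uw uw').
Qed.

Lemma walks_colored_nil col : (forall u, col u = 0) -> walks_colored col [::].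
Proof. by move=> e; split=> // u; rewrite e. Qed.

Lemma walks_colored_size col es : walks_colored col es -> k <= #|good X Y go| ->
  size es <= k ->
  (forall y, y \in good X Y go -> y \in es \/ size es = k) -> size es = k.
Proof.
move=> [ues _ _ _] kg le all; apply/eqP; rewrite eqn_leq le /=.
have [/eqP->//|ne] := boolP (size es == k).
rewrite -(card_uniqP ues) (leq_trans kg) // subset_leq_card //.
by apply/subsetP=> y /all[//|e]; rewrite e eqxx in ne.
Qed.

End WalkColoring.

Lemma notin_of (l l' : seq nat) b : all (fun x => x \notin l') l -> b \in l -> b \notin l'.
Proof. by move=> /allP h /h. Qed.

Lemma sub_mem_of (l l' : seq nat) b : all (mem l') l -> b \in l -> b \in l'.
Proof. by move=> /allP h /h. Qed.

(** * Colouring the walks by a program *)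

Section ColorProgram.

Variables (n k : nat) (G : sgraph 'I_n) (r r' c c' : 'I_n).
Variables (go : 'I_n -> option 'I_n).

Let X := nbhd G r :|: nbhd G c.
Let Y := nbhd G r' :|: nbhd G c'.

Hypothesis goP : forall w v, go w = Some v ->
  [/\ w \notin X, v \notin Y & (v == w) || G v w].
Hypothesis go_inj : forall w w' v, go w = Some v -> go w' = Some v -> w = w'.

Definition base (t : store) :=
  [/\ env k G t, terminals X Y t, forall w, owner t w = go w & forall w : 'I_n, t 4 w <= n].

Lemma base_frame s t : (forall b j, b \in [:: 0; 1; 3; 4; 6; 7] -> t b j = s b j) ->
  base s -> base t.
Proof.
move=> fr [h1 [hX hY] h2 h3]; split.
- by apply: env_frame h1 => b j; rewrite !inE => /or3P[]/eqP->; rewrite fr.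
- by split=> u; rewrite fr.
- by move=> w; rewrite /owner fr // -h2.
- by move=> w; rewrite fr.
Qed.

Lemma base_sem p s : all (fun b => b \notin writes p) [:: 0; 1; 3; 4; 6; 7] ->
  base s -> base (sem p s).
Proof. by move=> /allP h; apply: base_frame => b j /h; apply: sem_frame. Qed.

Definition WalkStep := When (Read 4 (Var 24)) (Set_ 24 (Pred (Read 4 (Var 24)))).

Lemma WalkStepP t (x : 'I_n) : base t -> t 24 0 = x -> sem WalkStep t 24 0 = step go x.
Proof.
move=> [_ _ ot t4] tx; rewrite sem_when /= tx /step -ot.
case e: (t 4 x) => [|m] /=; first by rewrite /owner e.
have mn : m < n by rewrite -e.
have -> : owner t x = Some (Ordinal mn) by apply/ownerP; rewrite e.
by rewrite sem_set /update /= tx e subn1.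
Qed.

Definition Walk := Set_ 24 (Var 14) ;; LFor 19 WalkStep.

Lemma WalkP t (y : 'I_n) : base t -> t 14 0 = y -> sem Walk t 24 0 = last_of go y.
Proof.
move=> bt ty; rewrite /Walk sem_seq sem_set; set t1 := update _ _ _ _.
have bt1 : base t1 by apply: base_frame bt => b j; rewrite /t1 /update; case: eqP => // ->.
have [[t0 _ _] _ _ _] := bt1.
have := @sem_for (fun i u => u 24 0 = iter i (step go) y) 19 WalkStep t1 n isT t0.
rewrite /last_of card_ord; apply; first by [].
move=> i u lt ui fr e; transitivity (sem WalkStep u 24 0) => //.
apply: WalkStepP => //; apply: base_frame bt1 => b j bin; apply: fr.
exact: notin_of bin.
Qed.

(** The counter is raised first, so colours start at 1. Once the walk has stopped, the remaining
    rounds recolour its last vertex. *)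
Definition ColorWalk :=
  Set_ 23 (Succ (Var 23)) ;; Set_ 24 (Var 14) ;;
  LFor 19 (LWrite 2 (Var 24) (Var 23) ;; WalkStep).

Lemma ColorWalkP t (y : 'I_n) : base t -> t 14 0 = y ->
  sem ColorWalk t 23 0 = (t 23 0).+1 /\
  forall u, color (sem ColorWalk t) u = if u \in walk go y then (t 23 0).+1 else color t u.
Proof.
move=> bt ty; rewrite /ColorWalk !sem_seq !sem_set.
set t1 := update _ 24 _ _.
have bt1 : base t1.
  apply: base_frame bt => b j bin; rewrite /t1 /update /=.
  have /negPf-> : b != 24 by apply: contraL bin => /eqP->.
  by have /negPf-> : b != 23 by apply: contraL bin => /eqP->.
have [[t0 _ _] _ _ _] := bt1.
have t23 : t1 23 0 = (t 23 0).+1 by rewrite /t1 /update /= addn1.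
split; first by rewrite sem_frame // t23.
move=> u.
have := @sem_for (fun i v => v 24 0 = iter i (step go) y /\ color v u =
   if [exists j : 'I_n, (j < i) && (u == iter j (step go) y)] then (t 23 0).+1 else color t u)
   19 (LWrite 2 (Var 24) (Var 23) ;; WalkStep) t1 n isT t0.
case=> [|i v lt vi fr [e1 e2]|_ e].
- split; first by [].
  by case: existsP => // -[j].
- set v1 := sem (LWrite 2 (Var 24) (Var 23)) v.
  have bv1 : base v1.
    apply: base_frame bt1 => b j bin; rewrite /v1 sem_frame; last exact: notin_of bin.
    by rewrite fr //; apply: notin_of bin.
  have v24 : v1 24 0 = iter i (step go) y by [].
  have v23 : v 23 0 = (t 23 0).+1 by rewrite fr.
  split.
    transitivity (sem WalkStep v1 24 0) => //; exact: WalkStepP.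
  transitivity (color v1 u); first exact: (@sem_frame WalkStep 2 u v1).
  rewrite /color /v1 sem_write /= e1 v23 /update /= val_eqE -/(color v u) e2.
  case: eqP => [eu|ne].
    case: existsP => // -[]; exists (Ordinal lt); by rewrite ltnSn eu eqxx.
  congr (if _ then _ else _); apply/existsP/existsP => -[j /andP[ji ej]]; exists j.
    by rewrite ej ltnW.
  move: ji; rewrite ltnS leq_eqVlt => /orP[/eqP ji|-> //].
  by case: ne; rewrite -ji; apply/eqP.
rewrite e; congr (if _ then _ else _); apply/existsP/imsetP => [[j /andP[_ /eqP->]]|[j _ ->]].
  by exists (cast_ord (esym (card_ord n)) j).
by exists (cast_ord (card_ord n) j); rewrite /= -[X in _ < X]card_ord ltn_ord eqxx.
Qed.

Definition ColorFrom :=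
  When (Defs.Sub K_ (Var 23)) (When (Read 7 (Var 14))
    (Walk ;; When (Read 6 (Var 24)) ColorWalk)).

Definition state t es :=
  [/\ base t, walks_colored G r r' c c' go (color t) es, t 23 0 = size es & size es <= k].

Lemma state_update t es a j x : a \notin [:: 0; 1; 2; 3; 4; 6; 7; 23] ->
  state t es -> state (update t a j x) es.
Proof.
move=> an [h1 h2 h3 h4].
have ne b : b \in [:: 0; 1; 2; 3; 4; 6; 7; 23] -> (b == a) = false.
  by move=> bin; apply/eqP => e; rewrite -e bin in an.
split=> //.
- apply: base_frame h1 => b j' bin; rewrite /update ne //.
  by apply: sub_mem_of bin.
- case: h2 => h21 h22 h23 h24; split=> //.
    by move=> u; rewrite /color /update ne //; apply: h23.
  move=> x0 i lt; rewrite -h24 //; apply/setP=> u.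
  by rewrite !inE /color /update ne.
- by rewrite /update ne.
Qed.

Lemma ColorFromP t es (y : 'I_n) : state t es -> t 14 0 = y -> y \notin es ->
  exists es', [/\ state (sem ColorFrom t) es', {subset es <= es'},
    {subset es' <= y :: es}, y \in good X Y go -> y \in es' \/ size es = k &
    size es = k -> es' = es].
Proof.
move=> st ty yes; have [bt wc t23 sk] := st; have [[_ tk _] [tX tY] _ _] := bt.
have skip : state t es -> (y \in good X Y go -> size es = k) -> exists es',
    [/\ state t es', {subset es <= es'}, {subset es' <= y :: es},
     y \in good X Y go -> y \in es' \/ size es = k & size es = k -> es' = es].
  move=> st' ng; exists es; split=> //; last by move=> /ng; right.
  by move=> x; rewrite inE orbC => ->.
rewrite /ColorFrom sem_when [eval _ _]/= tk t23 subn_eq0 -ltnNge.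
have [lt|ge] := ltnP (size es) k; last first.
  by apply: skip => // _; apply/eqP; rewrite eqn_leq sk ge.
rewrite sem_when [eval _ _]/= ty tY; case: ifPn => [yY|yY]; last first.
  by apply: skip => //; rewrite inE (negPf yY).
rewrite sem_seq; set t1 := sem Walk t.
have b1 : base t1 by apply: base_sem.
have t1y : t1 14 0 = y by rewrite /t1 sem_frame.
have t1l : t1 24 0 = last_of go y by apply: WalkP.
have t123 : t1 23 0 = size es by rewrite /t1 sem_frame.
have c1 u : color t1 u = color t u by rewrite /color /t1 sem_frame.
have st1 : state t1 es.
  split=> //; case: wc => w1 w2 w3 w4; split=> //; first by move=> u; rewrite c1.
  by move=> x0 i lti; rewrite -w4 //; apply/setP=> u; rewrite !inE c1.
have [_ [t1X _] _ _] := b1.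
rewrite sem_when [eval _ _]/= t1l t1X; case: ifPn => [lX|lX]; last first.
  exists es; split=> //; first by move=> x; rewrite inE orbC => ->.
  by rewrite inE (negPf lX) andbF.
have yg : y \in good X Y go by rewrite inE yY.
have [e23 ecol] := ColorWalkP b1 t1y.
exists (rcons es y); split.
- split; last by rewrite size_rcons.
  + exact: base_sem b1.
  + apply: (walks_colored_rcons goP go_inj wc yg yes) => u.
    by rewrite ecol t123 c1.
  + by rewrite e23 t123 size_rcons.
- by move=> x; rewrite mem_rcons inE orbC => ->.
- by move=> x; rewrite mem_rcons.
- by left; rewrite mem_rcons inE eqxx.
- by move=> e; rewrite e ltnn in lt.
Qed.

(** Starting points in [X] come first: either they exhaust the common vertices of [X] and [Y], or
    they already use up the [k] colours. These are the two cases of [walks_colored_balanced]. *)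
Definition ColorWalks :=
  Set_ 23 (Const 0) ;;
  LFor 14 (When (Read 6 (Var 14)) ColorFrom) ;;
  LFor 14 (Unless (Read 6 (Var 14)) ColorFrom).

Lemma ColorWalksP s : base s -> (forall u : 'I_n, color s u = 0) -> k <= #|good X Y go| ->
  exists es, [/\ state (sem ColorWalks s) es, size es = k &
    (forall y, y \in X -> y \in Y -> y \in es) \/ (forall y, y \in es -> y \in X)].
Proof.
move=> bs c0 kg; rewrite /ColorWalks !sem_seq sem_set; set s1 := update _ _ _ _.
have bs1 : base s1 by apply: base_frame bs => b j; rewrite /s1 /update; case: eqP => // ->.
have st1 : state s1 [::] by split=> //; apply: walks_colored_nil.
have [[s10 _ _] _ _ _] := bs1.
have ltS (i : nat) (lt : i < n) (y : 'I_n) : y < i.+1 -> y = Ordinal lt \/ y < i.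
  by rewrite ltnS leq_eqVlt => /orP[/eqP e|]; [left; exact: val_inj | right].
have [es1 [st2 es1X all1]] : exists es, [/\ state (sem (LFor 14 (When (Read 6 (Var 14)) ColorFrom)) s1) es,
    forall y : 'I_n, y \in es -> y < n /\ y \in X &
    forall y : 'I_n, y < n -> y \in good X Y go -> y \in X -> y \in es \/ size es = k].
  apply: (sem_for (I := fun i t => exists es, [/\ state t es,
    forall y : 'I_n, y \in es -> y < i /\ y \in X &
    forall y : 'I_n, y < i -> y \in good X Y go -> y \in X -> y \in es \/ size es = k])) => //.
    by exists [::]; split=> //; apply: state_update.
  move=> i t lt ti _ [es [st esX all]]; pose y : 'I_n := Ordinal lt.
  have [bt _ _ _] := st; have [_ [tX _] _ _] := bt.
  have ty : t 14 0 = y by [].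
  rewrite sem_when [eval _ _]/= ty tX; case: ifPn => yX.
    have yes : y \notin es by apply/negP => /esX[]; rewrite ltnn.
    have [es' [st' sub sub' yg full]] := ColorFromP st ty yes.
    exists es'; split; first exact: state_update.
    - move=> x /sub'; rewrite inE => /orP[/eqP->|/esX[xi xX]]; first by rewrite /= ltnSn.
      by rewrite ltnW.
    - move=> x /ltS[->|xi] xg xX; have [sk|sk] := eqVneq (size es) k.
      + by right; rewrite full.
      + by left; case: (yg xg) => // e; rewrite e eqxx in sk.
      + by right; rewrite full.
      + by left; apply: sub; case: (all x xi xg xX) => // e; rewrite e eqxx in sk.
  exists es; split; first exact: state_update.
  - by move=> x /esX[xi xX]; rewrite ltnW.
  - by move=> x /ltS[->|xi] xg xX; [rewrite xX in yX | apply: all].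
set s2 := sem _ s1 in st2 *.
have [[[s20 _ _] _ _ _] _ _ sk1] := st2.
have [es [st es_k triv all]] : exists es, [/\ state (sem (LFor 14 (Unless (Read 6 (Var 14)) ColorFrom)) s2) es,
    forall y : 'I_n, y \in es -> y \in X \/ y < n,
    (forall y, y \in X -> y \in Y -> y \in es) \/ (size es = k /\ forall y, y \in es -> y \in X) &
    forall y : 'I_n, y \in X \/ y < n -> y \in good X Y go -> y \in es \/ size es = k].
  apply: (sem_for (I := fun i t => exists es, [/\ state t es,
    forall y : 'I_n, y \in es -> y \in X \/ y < i,
    (forall y, y \in X -> y \in Y -> y \in es) \/ (size es = k /\ forall y, y \in es -> y \in X) &
    forall y : 'I_n, y \in X \/ y < i -> y \in good X Y go -> y \in es \/ size es = k])) => //.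
    exists es1; split.
    - exact: state_update.
    - by move=> y /es1X[_]; left.
    - have [sk|sk] := eqVneq (size es1) k; first by right; split=> // y /es1X[].
      (* A vertex of both [X] and [Y] is the end of its own walk, hence good, and was met by the
         first loop. *)
      left=> y yX yY; have yg : y \in good X Y go by rewrite inE yY (last_of_trivial goP).
      by case: (all1 y (ltn_ord y) yg yX) => // e; rewrite e eqxx in sk.
    - by move=> y [yX|//] yg; apply: all1.
  move=> i t lt ti _ [es [st esX triv all]]; pose y : 'I_n := Ordinal lt.
  have [bt _ _ _] := st; have [_ [tX _] _ _] := bt.
  have ty : t 14 0 = y by [].
  rewrite sem_unless [eval _ _]/= ty tX; case: ifPn => yX.
    exists es; split; [exact: state_update | | exact: triv |].
      by move=> x /esX[|xi]; [left | right; apply: ltnW].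
    by move=> x [xX|/ltS[->|xi]]; apply: all; [left | left | right].
  have yes : y \notin es by apply/negP => /esX[]; rewrite ?ltnn // => h; rewrite h in yX.
  have [es' [st' sub sub' yg full]] := ColorFromP st ty yes.
  exists es'; split; first exact: state_update.
  - move=> x /sub'; rewrite inE => /orP[/eqP->|/esX[xX|xi]]; [by right|by left|].
    by right; apply: ltnW.
  - case: triv => [tr|[sk tr]]; last by right; rewrite full.
    by left=> x xX xY; apply/sub/tr.
  - move=> x xi xg; have [sk|sk] := eqVneq (size es) k; first by right; rewrite full.
    left; case: xi => [xX|/ltS[exy|xi]].
    + by apply: sub; case: (all x (or_introl xX) xg) => // e; rewrite e eqxx in sk.
    + by move: xg; rewrite exy => /yg[//|e]; rewrite e eqxx in sk.
    + by apply: sub; case: (all x (or_intror xi) xg) => // e; rewrite e eqxx in sk.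
have [_ wc _ sk] := st.
have szk : size es = k.
  by apply: (walks_colored_size wc kg sk) => y; apply: all; right.
by exists es; split=> //; case: triv => [|[_]]; [left | right].
Qed.

End ColorProgram.

(** * From colourings to partitions *)

Section Labelling.

Variables (T : finType) (G : sgraph T) (k : nat).

Definition CDS_labelling (f : T -> nat) :=
  (forall u, 0 < f u <= k) /\
  (forall i, 0 < i <= k -> connected_dominating G (cls f i)).

Lemma CDS_labelling_partition f :
  CDS_labelling f -> CDS_partition G k (preim_partition f [set: T]).
Proof.
move=> [fk cds].
have E : preim_partition f [set: T] = [set cls f (i : 'I_k).+1 | i in 'I_k].
  apply/setP=> S; apply/imsetP/imsetP => [[x _ ->]|[i _ ->]].
    have /andP[f0 fle] := fk x; have lt : (f x).-1 < k by rewrite prednK.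
    exists (Ordinal lt) => //; apply/setP=> y; rewrite !inE /= prednK //.
  have [/set0Pn[x xi] _ _] := cds i.+1 (ltn_ord i).
  exists x; rewrite ?inE //; apply/setP=> y; move: xi; rewrite !inE => /eqP->.
  by rewrite eq_sym.
split; first exact: preim_partitionP.
- rewrite E card_imset ?card_ord // => i j e.
  have [/set0Pn[x xi] _ _] := cds i.+1 (ltn_ord i).
  have xj : x \in cls f j.+1 by rewrite -e.
  move: xi xj; rewrite !inE => /eqP xi /eqP xj; apply: val_inj => /=.
  by apply: succn_inj; rewrite -xi -xj.
- by rewrite E => S /imsetP[i _ ->]; exact: (cds i.+1 (ltn_ord i)).
Qed.

Lemma partial_coloring_labelling r r' c c' col f : 0 < k ->
  partial_coloring G k r r' c c' col ->
  (forall v i, 0 < i <= k -> v \notin cls col i -> exists2 w, w \in cls col i & G v w) ->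
  (forall u, f u = if col u == 0 then 1 else col u) ->
  CDS_labelling f.
Proof.
move=> k0 [h1 h2 h3 _ _] dom fE; split=> [u|i ik].
  by rewrite fE; case: eqP => [_|/eqP]; rewrite ?k0 // -lt0n => ->; rewrite h1.
have sub : cls col i \subset cls f i.
  have /andP[i0 _] := ik.
  by apply/subsetP=> u; rewrite !inE fE => /eqP ->; rewrite (gtn_eqF i0).
split.
- have /orP[] := h3 i ik => /exists_inP[u ui _];
  by apply/set0Pn; exists u; apply: (subsetP sub).
- by apply: connected_inS (h2 i ik) sub _ => u _ ui; apply: dom.
- move=> v vi; have [w wi vw] := dom v i ik (contra (subsetP sub v) vi).
  by exists w; rewrite ?(subsetP sub).
Qed.

End Labelling.

(** * Transport along a bijection of the vertices *)

Section Transport.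

Variables (T1 T2 : finType) (G1 : sgraph T1) (G2 : sgraph T2).
Variables (f : T1 -> T2) (g : T2 -> T1).
Hypotheses (fK : cancel f g) (gK : cancel g f).
Hypothesis fG : forall x y, G2 (f x) (f y) = G1 x y.

Lemma connected_in_imset (A : {set T1}) :
  connected_in G1 A -> connected_in G2 (f @: A).
Proof.
move=> cA _ _ /imsetP[x xA ->] /imsetP[y yA ->].
have /connectP[p] := cA x y xA yA; elim: p x xA => [|z p IHp] x xA /=.
  by move=> _ ->.
case/andP=> /and3P[_ zA xz] pzp ey.
apply: connect_trans (IHp z zA pzp ey); apply: connect1 => /=.
by rewrite !imset_f // fG.
Qed.

Lemma imset_cancel (A : {set T1}) : f @: A = g @^-1: A.
Proof.
apply/setP=> u; rewrite inE; apply/imsetP/idP => [[x xA ->]|gA]; first by rewrite fK.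
by exists (g u); rewrite ?gK.
Qed.

Lemma k_connected_transport k : k_connected G1 k -> k_connected G2 k.
Proof.
have cT : #|T2| = #|T1| by apply: esym; apply: bij_eq_card (Bijective fK gK).
move=> [kT cG]; split=> [|X Xk]; first by rewrite cT.
have -> : ~: X = f @: (~: (f @^-1: X)).
  by rewrite imset_cancel; apply/setP=> u; rewrite !inE gK.
apply: connected_in_imset; apply: cG; apply: leq_ltn_trans Xk.
by rewrite -(card_imset _ (can_inj fK)) subset_leq_card //; apply/subsetP=> _ /imsetP[x xX ->]; rewrite inE in xX.
Qed.

Lemma biconvex_transport : biconvex G1 -> biconvex G2.
Proof.
have gG x y : G1 (g x) (g y) = G2 x y by rewrite -fG !gK.
have lo (C : {set T1}) le : linear_order_on C le ->
    linear_order_on (g @^-1: C) (fun x y => le (g x) (g y)).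
  case=> h1 h2 h3 h4; split.
  - by move=> x; rewrite inE; apply: h1.
  - by move=> x y; rewrite !inE => xC yC h; rewrite -(gK x) -(gK y) (h2 _ _ xC yC h).
  - by move=> x y z; rewrite !inE; apply: h3.
  - by move=> x y; rewrite !inE; apply: h4.
have cs (C D : {set T1}) le : {in C, forall v, consecutive D le (nbhd G1 v)} ->
    {in g @^-1: C, forall v, consecutive (g @^-1: D) (fun x y => le (g x) (g y)) (nbhd G2 v)}.
  move=> h v; rewrite inE => vC x y z; rewrite !inE -!gG => xD yD zD xy yz vx vz.
  by have := h _ vC (g x) (g y) (g z) xD yD zD xy yz; rewrite !inE; apply.
case=> A [B [leA [leB [[AB AB0 cr] hA hB cA cB]]]].
exists (g @^-1: A), (g @^-1: B), (fun x y => leA (g x) (g y)), (fun x y => leB (g x) (g y)).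
split; [|exact: lo|exact: lo|exact: cs|exact: cs].
split.
- by apply/setP=> x; have := in_setT (g x); rewrite -AB !inE.
- by apply/setP=> x; have := in_set0 (g x); rewrite -AB0 !inE.
- by move=> x y; rewrite -gG !inE; apply: cr.
Qed.

Lemma CDS_labelling_transport k l : CDS_labelling G1 k l -> CDS_labelling G2 k (l \o g).
Proof.
move=> [h1 h2]; split=> [u|i ik]; first exact: h1.
have [n0 cS dS] := h2 i ik.
have E : cls (l \o g) i = f @: cls l i by rewrite imset_cancel; apply/setP=> u; rewrite !inE.
rewrite E; split; last 1 first.
- move=> v vn; have [|w wi vw] := dS (g v).
    by apply: contra vn => gv; rewrite -(gK v) imset_f.
  by exists (f w); rewrite ?imset_f // -(gK v) fG.
- by rewrite imset_eq0.
- exact: connected_in_imset.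
Qed.

End Transport.

(** * The complete program and its search *)

Definition Init :=
  LFor 14 (
    LWrite 4 (Var 14) (Const 0) ;; LWrite 5 (Var 14) (Const 0) ;;
    LWrite 2 (Var 14) (Const 0) ;;
    LWrite 6 (Var 14) (Add (Adj (Var 10) (Var 14)) (Adj (Var 12) (Var 14))) ;;
    LWrite 7 (Var 14) (Add (Adj (Var 11) (Var 14)) (Adj (Var 13) (Var 14)))).

(** After a success the body does nothing, which protects the labels from later guesses. *)
Definition Body :=
  Unless (Var 9)
   (compat_p ;;
    Unless (Var 8)
     (Init ;; Match ;; ColorWalks ;; Attach 10 11 ;; Attach 12 13 ;; Check ;;
      Unless (Var 8) Finish)).

Definition Offsets :=
  LFor 14 (LWrite 3 (Succ (Var 14)) (Add (Read 3 (Var 14)) N_)).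

Definition Main := Offsets ;; LFor 10 (LFor 11 (LFor 12 (LFor 13 Body))).

Lemma nth_allpairs (A B C : Type) (f : A -> B -> C) s t x0 y0 z i j :
  i < size s -> j < size t ->
  nth z [seq f x y | x <- s, y <- t] (i * size t + j) = f (nth x0 s i) (nth y0 t j).
Proof.
elim: s i => // x s IHs [|i] ilt jt; rewrite allpairs_cons nth_cat size_map.
  by rewrite jt (nth_map y0).
by rewrite mulSn -addnA ltnNge leq_addr /= addKn IHs.
Qed.

Section Main.

Variables (n k : nat) (G : sgraph 'I_n).
Hypotheses (k0 : 0 < k) (kG : k_connected G k).

Lemma InitP s r r' c c' : env k G s -> guess s r r' c c' ->
  let t := sem Init s in
  [/\ terminals (nbhd G r :|: nbhd G c) (nbhd G r' :|: nbhd G c') t,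
      forall u : 'I_n, t 4 u = 0, forall u : 'I_n, t 5 u = 0 &
      forall u : 'I_n, t 2 u = 0].
Proof.
move=> es [g1 g2 g3 g4] /=; have [s0 _ _] := es.
pose I i (t : store) := forall u : 'I_n, u < i ->
  [/\ t 4 u = 0, t 5 u = 0, t 2 u = 0, t 6 u = G r u + G c u & t 7 u = G r' u + G c' u].
suff H : I n (sem Init s).
  split=> [|u|u|u]; try by case: (H u (ltn_ord u)).
  split=> u; have [_ _ _ h6 h7] := H u (ltn_ord u).
    by rewrite h6 !inE; case: (G r u); case: (G c u).
  by rewrite h7 !inE; case: (G r' u); case: (G c' u).
apply: sem_for => // i t lt ti fr h u ui.
have et : env k G t by apply: (env_frame_for _ _ _ fr).
pose v : 'I_n := Ordinal lt; have [_ _ adj] := et.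
have e10 : t 10 0 = r by rewrite fr.
have e11 : t 11 0 = r' by rewrite fr.
have e12 : t 12 0 = c by rewrite fr.
have e13 : t 13 0 = c' by rewrite fr.
rewrite !sem_seq; set t1 := sem (LWrite 4 _ _) t; set t2 := sem (LWrite 5 _ _) t1.
set t3 := sem (LWrite 2 _ _) t2; set t4 := sem (LWrite 6 _ _) t3.
have f3 b j : b \notin [:: 2; 4; 5] -> t3 b j = t b j.
  by rewrite !inE !negb_or => /and3P[b2 b4 b5]; rewrite /t3 /t2 /t1 !sem_frame ?inE.
have f4 b j : b \notin [:: 2; 4; 5; 6] -> t4 b j = t b j.
  move=> bn; rewrite /t4 sem_frame; last by apply: contra bn; rewrite !inE orbC => ->; rewrite ?orbT.
  by rewrite f3 //; apply: contra bn; rewrite !inE !orbA => ->.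
have h4 j : t4 4 j = if j == i then 0 else t 4 j.
  by rewrite /t4 /t3 /t2 !(@sem_frame _ 4) // /t1 sem_write /update /= ti.
have h5 j : t4 5 j = if j == i then 0 else t 5 j.
  rewrite /t4 /t3 !(@sem_frame _ 5) // /t2 sem_write /update /= /t1.
  by rewrite !(@sem_frame _ 14, @sem_frame _ 5) // ti.
have h2 j : t4 2 j = if j == i then 0 else t 2 j.
  rewrite /t4 !(@sem_frame _ 2) // /t3 sem_write /update /= /t2 /t1.
  by rewrite !(@sem_frame _ 14, @sem_frame _ 2) // ti.
have h6 j : t4 6 j = if j == i then G r v + G c v else t 6 j.
  by rewrite /t4 sem_write /update /= !(f3 1, f3 3, f3 10, f3 12, f3 14) // ti e10 e12 -[i]/(val v) !adj.
rewrite sem_write /update /= !(f4 1, f4 3, f4 11, f4 13, f4 14) // ti e11 e13 -[i]/(val v) !adj h4 h5 h2 h6.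
have [uv|ne] := eqVneq u v; first by rewrite uv eqxx.
have {}ui : u < i.
  by move: ui; rewrite ltnS leq_eqVlt -[i]/(val v) val_eqE (negPf ne).
by rewrite (ltn_eqF ui); apply: h.
Qed.

Lemma OffsetsP : env k G (sem Offsets (input k G)).
Proof.
split; [by rewrite sem_frame | by rewrite sem_frame |].
have H : forall j, j <= n -> sem Offsets (input k G) 3 j = j * n.
  apply: (@sem_for (fun i t => forall j, j <= i -> t 3 j = j * n)) => //.
    by move=> j; rewrite leqn0 => /eqP->.
  move=> i t lt ti fr h j; rewrite leq_eqVlt sem_write => /orP[/eqP->|].
    by rewrite /update /= ti addn1 eqxx h // fr //= mulSn addnC.
  by rewrite ltnS => ji; rewrite /update /= ti addn1 (ltn_eqF (_ : j < i.+1)) // h.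
move=> u v; rewrite sem_frame // H ?(ltnW (ltn_ord u)) //=.
have sl : size (enum 'I_n) = n by rewrite size_enum_ord.
have := @nth_allpairs _ _ _ (fun u v => nat_of_bool (G u v)) (enum 'I_n) (enum 'I_n) u v 0 u v.
by rewrite sl !nth_ord_enum; apply.
Qed.

(** The first half holds for every guess, since success is declared only after the domination test.
    A controlling guess is needed for the second half alone: each class meets all four
    neighbourhoods, so the test cannot fail. *)
Lemma BodyP s r r' c c' : env k G s -> guess s r r' c c' -> s 9 0 = 0 ->
  let t := sem Body s in
  (t 9 0 != 0 -> CDS_labelling G k (fun u : 'I_n => t 2 u)) /\
  (compatible G r r' c c' -> controlling G r r' c c' -> t 9 0 != 0).
Proof.
move=> es gs s9 /=; have [kn cG] := kG; rewrite card_ord in kn.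
rewrite /Body sem_unless [eval _ _]/= s9 /= sem_seq; set s1 := sem compat_p s.
have es1 : env k G s1 by apply: env_sem.
have s19 : s1 9 0 = 0 by rewrite /s1 sem_frame.
have gs1 : guess s1 r r' c c' by case: gs => *; split; rewrite /s1 sem_frame.
rewrite sem_unless [eval _ _]/=; case: ifPn => [nc|]; last rewrite negbK.
  split; first by rewrite s19.
  by move=> cpt; have := (compat_pP es gs).2 cpt; rewrite (negPf nc).
move/(compat_pP es gs) => cpt.
rewrite [sem (Init ;; _) _]sem_seq [sem (Match ;; _) _]sem_seq [sem (ColorWalks ;; _) _]sem_seq
  [sem (Attach 10 11 ;; _) _]sem_seq [sem (Attach 12 13 ;; _) _]sem_seq [sem (Check ;; _) _]sem_seq.
set X := nbhd G r :|: nbhd G c; set Y := nbhd G r' :|: nbhd G c'.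
set s2 := sem Init s1; have es2 : env k G s2 by apply: env_sem.
have [ts2 z4 z5 z2] := InitP es1 gs1; rewrite -/s2 in ts2 z4 z5 z2.
have n1 : 1 < n by apply: leq_ltn_trans kn.
have inv := MatchP n1 es2 ts2 z4 z5.
set s3 := sem Match s2 in inv *.
pose go : 'I_n -> option 'I_n := owner s3.
have degk v : k <= #|nbhd G v| by apply: k_connected_degree.
have kX : k <= #|X| by apply: leq_trans (degk r) (subset_leq_card (subsetUl _ _)).
have kY : k <= #|Y| by apply: leq_trans (degk r') (subset_leq_card (subsetUl _ _)).
have [[es3 ts3 s34] [pm _] _ stuck _] := inv.
have goP w v : go w = Some v -> [/\ w \notin X, v \notin Y & (v == w) || G v w].
  by move=> ow; have [h _ _ _] := pm; have [] := h w v ow; rewrite !inE.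
have go_inj w w' v : go w = Some v -> go w' = Some v -> w = w'.
  by have [_ h _ _] := pm; apply: h.
(* With deficiency [#|X| - k] in Hall's condition, at most that many vertices outside [Y] stay
   unmatched; this is the count that [card_good] needs for [k] walks. *)
have good_k : k <= #|good X Y go|.
  apply: (card_good goP go_inj).
  have := @priced_matching_large _ _ _ _ _ _ (#|X| - k) pm.
  rewrite card_ord => /(_ _ _)/= H.
  have {H} : #|~: Y| <= #|matched go| + (#|X| - k).
    apply: H.
      move=> v; rewrite inE => vY nv w; rewrite inE => wX vw.
      have nv' w' : go w' <> Some v by apply/eqP/nv.
      by have [|h] := stuck v vY (ltn_ord v) nv'; last exact: h.
    by move=> Z; apply: k_connected_hall.
  have := cardsC Y; rewrite card_ord => e le.
  apply: (@leq_trans (#|Y| + #|~: Y| + k)); first by rewrite e.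
  rewrite -(addnA _ _ k) [#|X| + _]addnC -addnA leq_add2l.
  by rewrite (leq_trans (leq_add le (leqnn k))) // -addnA subnK // addnC.
have b3 : base k G r r' c c' go s3 by split.
have c3 (u : 'I_n) : color s3 u = 0 by rewrite /color /s3 (@sem_frame Match 2 u s2) // z2.
have [ys [[b4 wc _ _] szk triv]] := ColorWalksP goP go_inj b3 c3 good_k.
set s4 := sem ColorWalks s3 in b4 wc *.
have pc4 := walks_colored_partial goP go_inj wc szk.
have [bal4 bal4'] := walks_colored_balanced cpt goP go_inj wc szk triv.
have [es4 _ _ _] := b4.
have gs4 : guess s4 r r' c c'.
  by case: gs1 => *; split; rewrite /s4 /s3 /s2 !sem_frame.
have [g10 g11 g12 g13] := gs4.
have [pc5 mono5 hit5 keep5] := @AttachP _ _ _ _ 10 11 _ _ _ _ es4 isT isT g10 g11 (ltnW kn) cpt degk pc4 bal4.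
set s5 := sem (Attach 10 11) s4 in pc5 mono5 hit5 keep5 *.
have es5 : env k G s5 by apply: env_sem.
have bal5 : balanced G k c c' 0 (color s5).
  case: bal4' => b; [left=> u cu c'u|right=> i ik].
    by rewrite mono5 b.
  have /andP[i0 _] := ik.
  by rewrite !keep5 ?inE ?eqxx ?orbT //; apply: b.
have g12' : s5 12 0 = c by rewrite /s5 sem_frame.
have g13' : s5 13 0 = c' by rewrite /s5 sem_frame.
have [pc6 mono6 hit6 keep6] := @AttachP _ _ _ _ 12 13 _ _ _ _ es5 isT isT g12' g13' (ltnW kn)
  (compatible_swap cpt) degk (partial_coloring_swap pc5) bal5.
set s6 := sem (Attach 12 13) s5 in pc6 mono6 hit6 keep6 *.
have es6 : env k G s6 by apply: env_sem.
set s7 := sem Check s6.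
have es7 : env k G s7 by apply: env_sem.
have c7 u : color s7 u = color s6 u by rewrite /color /s7 sem_frame.
have s79 : s7 9 0 = 0.
  by rewrite /s7 /s6 /s5 /s4 /s3 /s2 /s1 !sem_frame.
have dom67 : (s7 8 0 == 0) -> forall v i, 0 < i <= k -> v \notin cls (color s6) i ->
    exists2 w, w \in cls (color s6) i & G v w.
  rewrite (CheckP es6) => /forallP H v [//|i] /andP[_ ik] vi.
  have /forallP/(_ (Ordinal (ltn_trans ik kn))) := H v.
  rewrite /= ik /=; rewrite inE in vi; rewrite (negPf vi) /=.
  by case/existsP=> w /andP[vw wi]; exists w; rewrite ?inE.
rewrite sem_unless [eval _ _]/=; case: ifPn => [bad|]; last rewrite negbK => ok.
  split; first by rewrite s79.
  move=> _ ctrl; case/negP: bad; rewrite (CheckP es6).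
  apply/forallP=> v; apply/forallP=> i; apply/implyP=> ik.
  apply/orP; have [ci|vi] := eqVneq (color s6 v) i.+1; [by left; apply/eqP | right].
  have [_ h2 _ _ _] := pc6; have hc := hit6 i.+1 ik; have hr := hit5 i.+1 ik.
  have [|||||w wi vw] := ctrl (cls (color s6) i.+1) (h2 i.+1 ik) _ _ _ _ v.
  - by rewrite keep6 ?inE ?eqxx //; case/andP: hr.
  - by rewrite keep6 ?inE ?eqxx ?orbT //; case/andP: hr.
  - by case/andP: hc.
  - by case/andP: hc.
  - by rewrite inE.
  by apply/existsP; exists w; rewrite vw; rewrite inE in wi.
split=> // _; apply: (partial_coloring_labelling k0 pc6 (dom67 ok)) => u.
have [s70 _ _] := es7.
by rewrite -c7 -FinishP.
Qed.

Definition found (t : store) := t 9 0 != 0.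

Definition search_inv t :=
  env k G t /\ (found t -> CDS_labelling G k (fun u : 'I_n => t 2 u)).

Definition finds p (B R : store -> Prop) := forall t, search_inv t -> B t ->
  [/\ search_inv (sem p t), found t -> found (sem p t) & R t -> found (sem p t)].

Lemma finds_for a p (B R B' R' : store -> Prop) :
  wf (LFor a p) -> a \notin [:: 0; 1; 2; 3; 9] ->
  (forall (t u : store) (i : 'I_n), B' t -> u a 0 = i ->
     (forall b j, b \notin a :: writes p -> u b j = t b j) -> B u) ->
  (forall t, R' t -> exists i : 'I_n, forall u : store, u a 0 = i ->
     (forall b j, b \notin a :: writes p -> u b j = t b j) -> R u) ->
  finds p B R -> finds (LFor a p) B' R'.
Proof.
move=> w an BB RR fp t0 [e0 l0] B0; have [t00 _ _] := e0.
have upd t i : [/\ search_inv t -> search_inv (update t a 0 i) & found (update t a 0 i) = found t].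
  have ne b : b \in [:: 0; 1; 2; 3; 9] -> (b == a) = false.
    by move=> bin; apply/eqP => e; rewrite -e bin in an.
  split; last by rewrite /found /update ne.
  case=> et lt; split.
    by apply: env_frame et => b j; rewrite !inE => /or3P[]/eqP->; rewrite /update ne.
  rewrite /found {1}/update ne //= => /lt [h1 h2].
  have E : (fun u : 'I_n => update t a 0 i 2 u) =1 (fun u : 'I_n => t 2 u).
    by move=> u; rewrite /update ne.
  by split=> [u|j jk]; [rewrite E | rewrite (eq_cls E); apply: h2].
pose Q (j : 'I_n) := forall u : store, u a 0 = j ->
  (forall b j, b \notin a :: writes p -> u b j = t0 b j) -> R u.
have [] : [/\ search_inv (sem (LFor a p) t0), found t0 -> found (sem (LFor a p) t0) &
    forall j : 'I_n, j < n -> Q j -> found (sem (LFor a p) t0)].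
  apply: (sem_for (I := fun i t => [/\ search_inv t, found t0 -> found t &
    forall j : 'I_n, j < i -> Q j -> found t])) => //.
    have [h1 h2] := upd t0 0; split=> //; [exact: h1 | by rewrite h2].
  move=> i t lt ti fr [h1 h2 h3]; pose v : 'I_n := Ordinal lt.
  have Bt : B t by apply: (BB t0 t v).
  have [g1 g2 g3] := fp t h1 Bt.
  have [u1 u2] := upd (sem p t) i.+1; split; rewrite ?u2; [exact: u1 | by move/h2 |].
  move=> j; rewrite ltnS leq_eqVlt => /orP[/eqP ji Qj|ji Qj]; last exact/g2/(h3 j).
  by apply: g3; apply: Qj => //; rewrite ti.
move=> h1 h2 h3; split=> // /RR[j Qj]; exact: (h3 j).
Qed.

Definition target r r' c c' := compatible G r r' c c' /\ controlling G r r' c c'.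

Lemma BodyP_finds : finds Body
  (fun t => [/\ t 10 0 < n, t 11 0 < n, t 12 0 < n & t 13 0 < n])
  (fun t => exists r r' c c', guess t r r' c c' /\ target r r' c c').
Proof.
move=> t [et lt] [b10 b11 b12 b13].
have [t9|t9] := eqVneq (t 9 0) 0; last first.
  have -> : sem Body t = t by rewrite /Body sem_unless [eval _ _]/= t9.
  by split.
have g0 : guess t (Ordinal b10) (Ordinal b11) (Ordinal b12) (Ordinal b13) by [].
have [h1 _] := BodyP et g0 t9; split.
- by split=> //; apply: env_sem.
- by rewrite /found t9.
- by case=> r [r' [c [c' [g [cp ct]]]]]; have [_] := BodyP et g t9; apply.
Qed.

Lemma MainP : (exists r r' c c', target r r' c c') ->
  CDS_labelling G k (fun u : 'I_n => sem Main (input k G) 2 u).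
Proof.
move=> ex; set s := sem Offsets (input k G).
have f4 := BodyP_finds.
have f3 : finds (LFor 13 Body)
    (fun t => [/\ t 10 0 < n, t 11 0 < n & t 12 0 < n])
    (fun t => exists r r' c c' : 'I_n, [/\ t 10 0 = r, t 11 0 = r', t 12 0 = c & target r r' c c']).
  apply: finds_for f4 => // [t u i [h1 h2 h3] ui fr|t [r [r' [c [c' [h1 h2 h3 tg]]]]]].
    by split; rewrite ?ui // fr.
  exists c' => u uc fr; exists r, r', c, c'; split=> //.
  by split; rewrite // fr.
have f2 : finds (LFor 12 (LFor 13 Body))
    (fun t => t 10 0 < n /\ t 11 0 < n)
    (fun t => exists r r' c c' : 'I_n, [/\ t 10 0 = r, t 11 0 = r' & target r r' c c']).
  apply: finds_for f3 => // [t u i [h1 h2] ui fr|t [r [r' [c [c' [h1 h2 tg]]]]]].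
    by split; rewrite ?ui // fr.
  exists c => u uc fr; exists r, r', c, c'.
  by split; rewrite // fr.
have f1 : finds (LFor 11 (LFor 12 (LFor 13 Body)))
    (fun t => t 10 0 < n)
    (fun t => exists r r' c c' : 'I_n, t 10 0 = r /\ target r r' c c').
  apply: finds_for f2 => // [t u i h1 ui fr|t [r [r' [c [c' [h1 tg]]]]]].
    by split; rewrite ?ui // fr.
  exists r' => u uc fr; exists r, r', c, c'.
  by split; rewrite // fr.
have f0 : finds (LFor 10 (LFor 11 (LFor 12 (LFor 13 Body)))) (fun=> True)
    (fun=> exists r r' c c', target r r' c c').
  apply: finds_for f1 => // [t u i _ ui fr|t [r [r' [c [c' tg]]]]].
    by rewrite ui.
  by exists r => u uc fr; exists r, r', c, c'.
have inv0 : search_inv s.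
  by split; [exact: OffsetsP | rewrite /found /s sem_frame].
have [[_ lab] _ hit] := f0 s inv0 I.
exact: lab (hit ex).
Qed.

End Main.

Theorem theorem6 :
  (forall (k : nat) (T : finType) (G : sgraph T),
     1 <= k -> k_connected G k -> biconvex G ->
     exists P : {set {set T}}, CDS_partition G k P)
  /\
  (exists (p : prog) (c d : nat),
     forall (k n : nat) (G : sgraph 'I_n),
       1 <= k -> k_connected G k -> biconvex G ->
       exists (t : nat) (s : store),
         [/\ exec p (input k G) t s, t <= c * n ^ d
           & CDS_partition G k (output n s)]).
Proof.
have main k n (G : sgraph 'I_n) : 1 <= k -> k_connected G k -> biconvex G ->
    CDS_labelling G k (fun u : 'I_n => sem Main (input k G) 2 u).
  move=> k0 kG bG; apply: MainP => //; apply: exists_controlling => //.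
    by apply: leq_ltn_trans k0 kG.1.
  exact: k_connected_connected kG k0.
split=> [k T G k0 kG bG|].
  (* For an arbitrary vertex type, the graph is renumbered by an enumeration, so existence too
     follows from the correctness of the program. *)
  pose G' := @SGraph 'I_#|T| (fun i j => G (enum_val i) (enum_val j))
    (fun i j => adj_sym G _ _) (fun i => adj_irrefl G _).
  have G'G x y : G' (enum_rank x) (enum_rank y) = G x y by rewrite /= !enum_rankK.
  have kG' := k_connected_transport (@enum_rankK T) (@enum_valK T) G'G kG.
  have bG' := biconvex_transport (@enum_valK T) G'G bG.
  have lab := CDS_labelling_transport (G1 := G') (G2 := G) (@enum_valK T) (@enum_rankK T)
    (fun _ _ => erefl) (main _ _ _ k0 kG' bG').
  by eexists; apply: CDS_labelling_partition lab.
have [c [d cd]] := cost_poly Main.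
exists (compile Main), c, d => k n G k0 kG bG.
have n0 : 0 < n by have := kG.1; rewrite card_ord; apply: leq_ltn_trans.
have [t e tc] := @compile_correct Main (input k G) isT.
exists t, (sem Main (input k G)); split=> //.
  exact: leq_trans tc (cd _ n0).
exact: CDS_labelling_partition (main _ _ _ k0 kG bG).
Qed.
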